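(* For $k\ge2$, the functions $$J_k=E_k-\sum_{j=2}^kQ_jQ_{k+2-j}+\frac14\sum_{j=2}^{k-1}\big(E_jE_{k+1-j}-F_jF_{k+1-j}\big)$$ are independent constants of motion of the Kirchhoff-Pohozaev equation which are well defined on $\mathcal H^k$.
   Context: The Kirchhoff-Pohozaev equation on $\mathbb T^n$ ($n\ge1$) is $u_{tt}-\big(1+\int_{\mathbb T^n}|\nabla u|^2dx\big)^{-2}\Delta u=0$, i.e. the Hamiltonian system $u_t=\nabla_vH$, $v_t=-\nabla_uH$ with $H(u,v)=\frac12\int_{\mathbb T^n}v^2dx-\frac12\frac1{1+\int_{\mathbb T^n}|\nabla u|^2dx}$ and Poisson bracket $\{F,G\}=\int_{\mathbb T^n}(\nabla_uF\nabla_vG-\nabla_vF\nabla_uG)dx$ ($L^2$-gradients). Phase space: $\mathcal H^s=H^s(\mathbb T^n)\times H^{s-1}(\mathbb T^n)$, $s\ge1$. Notation: $\nabla^{2k}u=\Delta^ku$, $\nabla^{2k+1}u=\nabla(\Delta^ku)$, $\|\cdot\|$ is the $L^2(\mathbb T^n)$ norm. For $(u,v)\in\mathcal H^s$ and integers $1\le k\le s$: $D_k=\|\nabla^ku\|^2$, $B_k=\|\nabla^{k-1}v\|^2$, $Q_k=\int_{\mathbb T^n}\nabla^{k-1}u\cdot\nabla^{k-1}v\,dx$, $A=\frac1{1+D_1}$, $E_k=\frac{B_k}A+AD_k$, $F_k=\frac{B_k}A-AD_k$. Empty sums are zero. *)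

(* Defs.v *)
From HB Require Import structures.
From mathcomp Require Import all_boot all_order all_algebra.
From mathcomp Require Import all_classical all_reals all_analysis.

Set Implicit Arguments.
Unset Strict Implicit.
Unset Printing Implicit Defensive.

Import Order.TTheory GRing.Theory Num.Theory.
Import numFieldNormedType.Exports.

Local Open Scope classical_set_scope.
Local Open Scope ring_scope.

(* The torus is (R / 2 pi Z)^n. A function on it is represented by a function on
   R^n, of which only the values on the fundamental domain [0, 2 pi]^n matter:
   the reference measure is Lebesgue measure restricted to that box. *)
Notation tpoint R n := (n.-tuple (measurableTypeR R)).
Notation state R n := ((tpoint R n -> R) * (tpoint R n -> R))%type.

Section torus_measure.
Variable R : realType.
Local Open Scope ereal_scope.

Lemma circle_lty :
  (@lebesgue_measure R) `[0%R, (pi *+ 2)%R]%classic < +oo.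
Proof. by rewrite lebesgue_measure_itv/=; case: ifP => _; rewrite ltry. Qed.

Definition circle_measure : {finite_measure set (measurableTypeR R) -> \bar R} :=
  @mfrestr _ (measurableTypeR R) R _ (@lebesgue_measure R)
    (measurable_itv `[0%R, (pi *+ 2)%R]) circle_lty.

Definition tcons n (p : measurableTypeR R * tpoint R n) : tpoint R n.+1 :=
  [tuple of p.1 :: p.2].

Lemma measurable_tcons n : measurable_fun [set: _] (@tcons n).
Proof. exact: measurable_cons. Qed.

Section cons_measure.
Variables (n : nat) (mu : {finite_measure set (tpoint R n) -> \bar R}).

Definition cons_measure : set (tpoint R n.+1) -> \bar R :=
  pushforward (circle_measure \x mu) (@tcons n).

Let cons_measure0 : cons_measure set0 = 0.
Proof. by rewrite /cons_measure /pushforward preimage_set0 measure0. Qed.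

Let cons_measure_ge0 A : 0 <= cons_measure A.
Proof. exact: (measure_ge0 (circle_measure \x mu)). Qed.

Let cons_measure_sigma_additive : semi_sigma_additive cons_measure.
Proof.
exact: (@measure_semi_sigma_additive _ _ _
  (measure_function_pushforward__canonical__measure_function_Measure
    (circle_measure \x mu) (@measurable_tcons n))).
Qed.

HB.instance Definition _ := isMeasure.Build _ _ _ cons_measure
  cons_measure0 cons_measure_ge0 cons_measure_sigma_additive.

Let cons_measure_fin : fin_num_fun cons_measure.
Proof.
move=> A mA; rewrite ge0_fin_numE//.
apply: (@le_lt_trans _ _ (cons_measure setT)).
  by apply: le_measure => //; rewrite ?inE.
rewrite /cons_measure /pushforward preimage_setT -setXTT product_measure1E//.
by rewrite lte_mul_pinfty// -?ge0_fin_numE// fin_num_measure.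
Qed.

HB.instance Definition _ :=
  Measure_isFinite.Build _ _ _ cons_measure cons_measure_fin.

End cons_measure.

(* n-fold product of circle_measure *)
Fixpoint torus_measure n : {finite_measure set (tpoint R n) -> \bar R} :=
  if n is n'.+1 then cons_measure (torus_measure n') else dirac [tuple].

End torus_measure.

Section functions_on_torus.
Variables (R : realType) (n : nat).
Implicit Types (u v w f g : tpoint R n -> R) (i : 'I_n) (k s N : nat).

Local Notation mu := (torus_measure R n).

Definition freq := {ffun 'I_n -> int}.

Definition phase (m : freq) (x : tpoint R n) : R :=
  \sum_(i < n) (m i)%:~R * tnth x i.

Definition freq_sqr (m : freq) : R := \sum_(i < n) (m i)%:~R ^+ 2.

(* The Fourier coefficient (2 pi)^-n * \int u(x) exp(- i m.x) dx of a real
   function u is fourier_cos u m - i * fourier_sin u m. *)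
Definition fourier_cos u (m : freq) : R :=
  (pi *+ 2) ^- n * \int[mu]_x (u x * cos (phase m x)).
Definition fourier_sin u (m : freq) : R :=
  (pi *+ 2) ^- n * \int[mu]_x (u x * sin (phase m x)).

Definition box_freq N (q : {ffun 'I_n -> 'I_(N.*2.+1)}) : freq :=
  [ffun i => (q i)%:Z - N%:Z].

(* i-th partial derivative of the partial Fourier sum of u over the frequencies
   in [-N, N]^n *)
Definition partial_of_fourier_sum N u i (x : tpoint R n) : R :=
  \sum_(q : {ffun 'I_n -> 'I_(N.*2.+1)}) let m := box_freq q in
    (m i)%:~R * (fourier_sin u m * cos (phase m x)
                 - fourier_cos u m * sin (phase m x)).

(* Derivatives are those of Fourier series: the series of u differentiated term
   by term converges in L^2 to w. *)
Definition is_partial i u w : Prop :=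
  w \in Lfun mu 2%:E /\
  ('N[mu]_2%:E[EFin \o (fun x => partial_of_fourier_sum N u i x - w x)%R])%E
    @[N --> \oo] --> 0%E.

Definition partial i u : tpoint R n -> R := xget (cst 0) [set w | is_partial i u w].

Definition has_partial i u : Prop := exists w, is_partial i u w.

Definition laplacian u : tpoint R n -> R :=
  fun x => \sum_(i < n) partial i (partial i u) x.

(* nabla^(2j) = laplacian^j is scalar, nabla^(2j+1) = grad laplacian^j is a
   vector; nabla_dot k f g is the pointwise product nabla^k f . nabla^k g. *)
Definition nabla_dot k f g : tpoint R n -> R :=
  let lf := iter k./2 laplacian f in
  let lg := iter k./2 laplacian g in
  fun x => if odd k then \sum_(i < n) partial i lf x * partial i lg x
           else lf x * lg x.

(* All the derivatives entering nabla^k u exist in L^2. *)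
Definition has_nabla k u : Prop :=
  (forall j i, (j < k./2)%N ->
     has_partial i (iter j laplacian u) /\
     has_partial i (partial i (iter j laplacian u))) /\
  (odd k -> forall i, has_partial i (iter k./2 laplacian u)).

(* Squared norm of H^s(T^n), with values in [0, +oo] *)
Definition sobolev_sqr s u : \bar R :=
  (\esum_(m in [set: freq])
    ((1 + freq_sqr m) ^+ s
      * (fourier_cos u m ^+ 2 + fourier_sin u m ^+ 2))%R%:E)%E.

Definition sobolev s : set (tpoint R n -> R) :=
  [set u | u \in Lfun mu 2%:E /\ (sobolev_sqr s u < +oo)%E].

(* The phase space H^s x H^(s-1), for integers s >= 1 *)
Definition phase_space s : set (state R n) :=
  [set p | sobolev s p.1 /\ sobolev s.-1 p.2].

Definition phase_dist_sqr s (p q : state R n) : \bar R :=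
  (sobolev_sqr s (fun x => p.1 x - q.1 x)%R
   + sobolev_sqr s.-1 (fun x => p.2 x - q.2 x)%R)%E.

Section functionals.
Variable p : state R n.
Local Notation u := p.1.
Local Notation v := p.2.

Definition D_ k : R := \int[mu]_x nabla_dot k u u x.
Definition B_ k : R := \int[mu]_x nabla_dot k.-1 v v x.
Definition Q_ k : R := \int[mu]_x nabla_dot k.-1 u v x.
Definition A_ : R := (1 + D_ 1)^-1.
Definition E_ k : R := B_ k / A_ + A_ * D_ k.
Definition F_ k : R := B_ k / A_ - A_ * D_ k.

Definition J_ k : R :=
  E_ k - \sum_(2 <= j < k.+1) Q_ j * Q_ (k + 2 - j)
  + 4^-1 * \sum_(2 <= j < k) (E_ j * E_ (k + 1 - j) - F_ j * F_ (k + 1 - j)).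

End functionals.

(* (u, v) in C(I, H^k x H^(k-1)) with u in C^1(I, H^(k-1)),
   v in C^1(I, H^(k-2)) and u_t = v, v_t = (1 + \int |nabla u|^2)^-2 Delta u;
   derivatives at end points of I are one-sided. *)
Definition kirchhoff_pohozaev_solution k (I : set R)
    (u v : R -> tpoint R n -> R) : Prop :=
  forall t, I t ->
  [/\ phase_space k (u t, v t),
      phase_dist_sqr k (u r, v r) (u t, v t) @[r --> within I t^'] --> 0%E,
      sobolev_sqr k.-1 (fun x => (u r x - u t x) / (r - t) - v t x)
        @[r --> within I t^'] --> 0%E &
      sobolev_sqr k.-2 (fun x => (v r x - v t x) / (r - t)
          - (1 + \int[mu]_y nabla_dot 1 (u t) (u t) y) ^- 2
            * laplacian (u t) x)
        @[r --> within I t^'] --> 0%E].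

Definition constant_of_motion k
    (J : state R n -> R) : Prop :=
  forall (I : set R) (u v : R -> tpoint R n -> R), is_interval I ->
    kirchhoff_pohozaev_solution k I u v ->
    forall t1 t2, I t1 -> I t2 -> J (u t1, v t1) = J (u t2, v t2).

(* On H^k x H^(k-1) every derivative and every integral in the definition of J_k
   exists, and J_k does not depend on the choice of representatives. *)
Definition J_well_defined k : Prop :=
  (forall u v, phase_space k (u, v) -> forall j, (1 <= j <= k)%N ->
    [/\ has_nabla j u, has_nabla j.-1 v,
        mu.-integrable setT (EFin \o nabla_dot j u u),
        mu.-integrable setT (EFin \o nabla_dot j.-1 v v) &
        mu.-integrable setT (EFin \o nabla_dot j.-1 u v)]) /\
  (forall u v u' v', phase_space k (u, v) -> phase_space k (u', v') ->
    {ae mu, forall x, u x = u' x} -> {ae mu, forall x, v x = v' x} ->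
    J_ (u, v) k = J_ (u', v') k).

Definition along (p h : state R n) (t : R) :=
  ((fun x => p.1 x + t * h.1 x), (fun x => p.2 x + t * h.2 x)).

(* The differentials at p of J_2, ..., J_K, as functionals on
   H^K x H^(K-1), exist and are linearly independent. *)
Definition independent_at K (p : state R n) : Prop :=
  (forall k h, (2 <= k <= K)%N -> phase_space K h ->
    derivable (fun t : R => J_ (along p h t) k) 0 1) /\
  (forall c : nat -> R,
    (forall h, phase_space K h ->
      \sum_(2 <= k < K.+1) c k * derive1 (fun t : R => J_ (along p h t) k) 0 = 0) ->
    forall k, (2 <= k <= K)%N -> c k = 0).

(* Functional independence of J_2, ..., J_K: their differentials are linearly
   independent on an open dense subset of their common domain. *)
Definition J_independent K : Prop :=
  exists U : set (state R n),
  [/\ U `<=` phase_space K,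
      (forall p, U p -> exists2 e : R, 0 < e &
        forall q, phase_space K q -> (phase_dist_sqr K q p < e%:E)%E -> U q),
      (forall p (e : R), phase_space K p -> 0 < e ->
        exists2 q, U q & (phase_dist_sqr K q p < e%:E)%E) &
      forall p, U p -> independent_at K p].

End functions_on_torus.

(* Main.v *)
Require Import Defs.
From mathcomp Require Import all_boot all_order all_algebra.
From mathcomp Require Import all_classical all_reals all_analysis measurable_realfun.
From mathcomp Require Import ring lra zify.

Set Implicit Arguments.
Unset Strict Implicit.
Unset Printing Implicit Defensive.

Import Order.TTheory GRing.Theory Num.Theory.
Import numFieldNormedType.Exports.

Local Open Scope classical_set_scope.
Local Open Scope ring_scope.

(** All indices in J_k are at least 2, apart from D_1 inside A, so J_k involves u
    and v only through their derivatives, and these are defined by Fourier series.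
    Hence J_k is a function of the Fourier coefficients of the state: writing
    lambda for the squared frequency, D_k, B_k and Q_k are the sums over all
    frequencies of lambda^k |u|^2, lambda^(k-1) |v|^2 and lambda^(k-1) Re(u conj v)
    ([nabla_dot_cvg]). This rests on the orthogonality of the trigonometric system
    ([ip_trig]) and on the completeness of L^2 ([Riesz_Fischer]), which provides
    the derivatives of a function in H^k as sums of their Fourier series
    ([series_exists]). It gives that J_k is well defined on H^k x H^(k-1).

    Conservation. A solution satisfies the mode equations u' = v and
    v' = - A^2 lambda u for each frequency, and formally
      D_j' = 2 Q_(j+1),  B_j' = - 2 A^2 Q_(j+1),  Q_j' = B_j - A^2 D_j = A F_j,
      A' = - 2 A^2 Q_2,
    whence E_j' = 2 A Q_2 F_j and F_j' = 2 A Q_2 E_j - 4 A Q_(j+1), and the sums in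
    J_k' telescope to 0. In H^k x H^(k-1) the quantity Q_(k+1) does not exist, so
    the computation is made with all sums over frequencies truncated to a box of
    size N, except the one in A. What remains is exactly
    2 A F_k (Q_2 exact - Q_2 truncated), see [Jform_derive]. The truncated
    quadratic forms converge as N tends to infinity and the time tends to t jointly,
    because they are bounded by Sobolev norms uniformly in N ([bform_joint]); so
    this remainder tends to 0 jointly, and by the mean value inequality J_k has
    derivative 0 at t ([quot_limit], [quot_J]).

    Independence. In a direction (0, w) the quantities A and D_j do not vary, and
    for w a cosine or a sine of frequency m the differential of J_k is
      V P_k(lambda) + U S_k(lambda),
    where U and V are the corresponding coefficients of u and v at m, S_k is a
    function of lambda, and P_k is a polynomial of degree k - 1 with leading
    coefficient 2 / A. If the sum of the c_k dJ_k vanishes, the cosine and the sine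
    directions give two linear equations for the sums of the c_k P_k(lambda) and of
    the c_k S_k(lambda); when the determinant of (u, v) at m is not zero they force
    the former to vanish. Having this at K frequencies with distinct lambda kills a
    polynomial of degree less than K, and then the c_k, by their degrees
    ([independent_wronskian]). The determinants at finitely many frequencies do not
    vanish on an open dense set: along a suitable line each of them is a quadratic
    polynomial with leading coefficient 1 / 4 ([wronskian_open],
    [wronskian_dense]). *)

(** * Square-integrable functions on a finite measure space *)
Section square_integrable.
Context d (T : measurableType d) (R : realType).
Variable mu : {finite_measure set T -> \bar R}.
Implicit Types f g h : T -> R.

Local Notation L2 f := (f \in Lfun mu 2%:E).

(** The real-valued inner product: together with [Lnorm2E] it replaces extended
    real norms by elements of [R]. *)
Definition ip f g : R := \int[mu]_x (f x * g x).

Let le12 : (1 <= 2%:E :> \bar R)%E. Proof. by rewrite lee_fin ler1n. Qed.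

Lemma L2D f g : L2 f -> L2 g -> L2 (fun x => f x + g x).
Proof.
move=> hf hg; have [_ H] := @Lfun_addr_closed d T R mu 2%:E le12.
exact: (H f g hf hg).
Qed.

Lemma L2Z a f : L2 f -> L2 (fun x => a * f x).
Proof.
move=> hf; have h12 : (1 <= 2 :> R) by rewrite ler1n.
suff -> : (fun x => a * f x) = a \o* f by exact: Lfun_scale.
by apply/funext => x /=; rewrite mulrC.
Qed.

Lemma L2N f : L2 f -> L2 (fun x => - f x).
Proof. by move=> hf; have := Lfun_oppr_closed hf. Qed.

Lemma L2B f g : L2 f -> L2 g -> L2 (fun x => f x - g x).
Proof. by move=> hf hg; apply: L2D => //; exact: L2N. Qed.

Lemma L2_sum (I : Type) (s : seq I) (F : I -> T -> R) :
  (forall i, L2 (F i)) -> L2 (fun x => \sum_(i <- s) F i x).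
Proof.
move=> hF; elim: s => [|i s IH].
  by under eq_fun do rewrite big_nil; exact: Lfun_cst.
by under eq_fun do rewrite big_cons; exact: L2D.
Qed.

Lemma L2_measurable f : L2 f -> measurable_fun setT f.
Proof. by rewrite inE => /andP[]; rewrite inE. Qed.

Lemma L2_integrableM f g : L2 f -> L2 g ->
  mu.-integrable setT (EFin \o (fun x => f x * g x)).
Proof. by move=> hf hg; apply/Lfun1_integrable; exact: Lfun2_mul_Lfun1. Qed.

Lemma L2_integrable f : L2 f -> mu.-integrable setT (EFin \o f).
Proof.
move=> hf; suff -> : f = (fun x => f x * 1) by apply: L2_integrableM => //; exact: Lfun_cst.
by apply/funext => x; rewrite mulr1.
Qed.

Lemma ipE f g : L2 f -> L2 g ->
  (ip f g)%:E = (\int[mu]_x (f x * g x)%:E)%E.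
Proof.
move=> hf hg; rewrite /ip /Rintegral fineK//.
exact: (integrable_fin_num measurableT (L2_integrableM hf hg)).
Qed.

Lemma ipC f g : ip f g = ip g f.
Proof. by apply: eq_Rintegral => x _; rewrite mulrC. Qed.

Lemma ipDl f g h : L2 f -> L2 g -> L2 h ->
  ip (fun x => f x + g x) h = ip f h + ip g h.
Proof.
move=> hf hg hh; rewrite /ip -RintegralD//; try exact: L2_integrableM.
by apply: eq_Rintegral => x _; rewrite mulrDl.
Qed.

Lemma ipZl a f g : L2 f -> L2 g -> ip (fun x => a * f x) g = a * ip f g.
Proof.
move=> hf hg; rewrite /ip -RintegralZl//; last exact: L2_integrableM.
by apply: eq_Rintegral => x _; rewrite mulrA.
Qed.

Lemma ipNl f g : L2 f -> L2 g -> ip (fun x => - f x) g = - ip f g.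
Proof.
move=> hf hg; rewrite -mulN1r -ipZl//.
by apply: eq_Rintegral => x _; rewrite mulN1r.
Qed.

Lemma ipBl f g h : L2 f -> L2 g -> L2 h ->
  ip (fun x => f x - g x) h = ip f h - ip g h.
Proof. by move=> hf hg hh; rewrite ipDl ?ipNl//; exact: L2N. Qed.

Lemma ipBr f g h : L2 f -> L2 g -> L2 h ->
  ip h (fun x => f x - g x) = ip h f - ip h g.
Proof. by move=> hf hg hh; rewrite ipC ipBl// !(ipC h). Qed.

Lemma ip_suml (I : Type) (s : seq I) (F : I -> T -> R) g :
  (forall i, L2 (F i)) -> L2 g ->
  ip (fun x => \sum_(i <- s) F i x) g = \sum_(i <- s) ip (F i) g.
Proof.
move=> hF hg; elim: s => [|i s IH].
  rewrite big_nil /ip.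
  under eq_Rintegral do rewrite big_nil mul0r.
  by rewrite Rintegral_cst// mul0r.
rewrite big_cons -IH -ipDl//; last exact: L2_sum.
by apply: eq_Rintegral => x _; rewrite big_cons.
Qed.

Lemma ip_ge0 f : 0 <= ip f f.
Proof. by apply: Rintegral_ge0 => x _; rewrite -expr2 sqr_ge0. Qed.

Lemma Lnorm2E f : L2 f -> ('N[mu]_2%:E[EFin \o f] = (Num.sqrt (ip f f))%:E)%E.
Proof.
move=> hf; rewrite unlock /=.
rewrite (_ : (\int[mu]_x _)%E = (ip f f)%:E).
  by rewrite poweR_EFin powR12_sqrt// ip_ge0.
rewrite ipE//; apply: eq_integral => x _.
by rewrite /= powR_mulrn// -normrX expr2 ger0_norm// -expr2 sqr_ge0.
Qed.

Lemma ip_cauchy f g : L2 f -> L2 g ->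
  `|ip f g| <= Num.sqrt (ip f f) * Num.sqrt (ip g g).
Proof.
move=> hf hg.
have h2 : (2^-1 + 2^-1 = 1 :> R) by rewrite [RHS]splitr !div1r.
have := @hoelder _ _ _ mu f g 2 2 (L2_measurable hf) (L2_measurable hg)
  (ltr0Sn R 1) (ltr0Sn R 1) h2.
rewrite !Lnorm2E// -EFinM Lnorm1 -lee_fin; apply: le_trans.
rewrite (EFin_normr_Rintegral measurableT (L2_integrableM hf hg)).
apply: le_trans (le_abse_integral _ _ _) _ => //.
by have /integrableP[] := L2_integrableM hf hg.
Qed.

End square_integrable.

Section L2_convergence.
Context d (T : measurableType d) (R : realType).
Variable mu : {finite_measure set T -> \bar R}.
Implicit Types (f g h : T -> R) (F G : nat -> T -> R).

Local Notation L2 f := (f \in Lfun mu 2%:E).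

Definition cvgL2 F f : Prop :=
  ip mu (fun x => F N x - f x) (fun x => F N x - f x) @[N --> \oo] --> 0.

Lemma cvgL2P F f : (forall N, L2 (F N)) -> L2 f ->
  ('N[mu]_2%:E[EFin \o (fun x => F N x - f x)%R] @[N --> \oo] --> 0)%E <->
  cvgL2 F f.
Proof.
move=> hF hf; have hD N := L2B (hF N) hf.
under eq_fun do rewrite Lnorm2E//.
rewrite -[X in _ --> X]/(EFin 0); split.
  move=> /fine_cvgP[_]/= H.
  have := cvgM H H; rewrite mulr0 /cvgL2.
  rewrite (_ : (_ \* _) = (fun N => ip mu (fun x => F N x - f x) (fun x => F N x - f x))).
    by move=> H'; exact: H'.
  by apply/funext => N /=; rewrite -expr2 sqr_sqrtr ?ip_ge0.
move=> H; apply: cvg_EFin; first exact: nearW.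
have /(_ 0) := @sqrt_continuous R; rewrite /continuous_at sqrtr0.
exact: (cvg_comp _ _ H).
Qed.

(** Joint continuity of the inner product. *)
Lemma cvgL2_ip F G f g : (forall N, L2 (F N)) -> L2 f ->
    (forall N, L2 (G N)) -> L2 g -> cvgL2 F f -> cvgL2 G g ->
  ip mu (F N) (G N) @[N --> \oo] --> ip mu f g.
Proof.
move=> hF hf hG hg Ff Gg.
have sq (a : nat -> R) : a N @[N --> \oo] --> 0 -> Num.sqrt (a N) @[N --> \oo] --> 0.
  have /(_ 0) := @sqrt_continuous R; rewrite /continuous_at sqrtr0 => c H.
  exact: (cvg_comp _ _ H).
have {}Ff := sq _ Ff; have {}Gg := sq _ Gg.
apply/subr_cvg0/norm_cvg0P.
pose a N := Num.sqrt (ip mu (fun x => F N x - f x) (fun x => F N x - f x)).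
pose b N := Num.sqrt (ip mu (fun x => G N x - g x) (fun x => G N x - g x)).
apply: (@squeeze_cvgr _ _ _ _ (fun=> 0) (fun N =>
   a N * b N + a N * Num.sqrt (ip mu g g) + Num.sqrt (ip mu f f) * b N)).
- near=> N; rewrite normr_ge0/=.
  have -> : ip mu (F N) (G N) - ip mu f g =
      ip mu (fun x => F N x - f x) (fun x => G N x - g x)
      + ip mu (fun x => F N x - f x) g + ip mu f (fun x => G N x - g x).
    rewrite !(ipBl, ipBr)//; last exact: L2B.
    ring.
  apply: le_trans (ler_normD _ _) _; apply: lerD; last first.
    by apply: ip_cauchy => //; exact: L2B.
  apply: le_trans (ler_normD _ _) _; apply: lerD; apply: ip_cauchy => //; exact: L2B.
- exact: cvg_cst.
- have E : 0 * 0 + 0 * Num.sqrt (ip mu g g) + Num.sqrt (ip mu f f) * 0 = 0 :> R by ring.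
  rewrite -E; apply: cvgD; last by apply: cvgM => //; exact: cvg_cst.
  by apply: cvgD; apply: cvgM => //; exact: cvg_cst.
Unshelve. all: by end_near. Qed.

Lemma ip_cst1 f : L2 f -> ip mu f (cst 1) = \int[mu]_x f x.
Proof. by move=> hf; apply: eq_Rintegral => x _; rewrite mulr1. Qed.

End L2_convergence.

Section Riesz_Fischer.
Context d (T : measurableType d) (R : realType).
Variable mu : {finite_measure set T -> \bar R}.
Implicit Types (f g h : T -> R) (F G : nat -> T -> R).

Local Notation L2 f := (f \in Lfun mu 2%:E).

Lemma L2_of_sqr f : measurable_fun setT f ->
  (\int[mu]_x (f x * f x)%:E < +oo)%E -> L2 f.
Proof.
move=> mf ff; rewrite inE; apply/andP; split; first by rewrite inE.
rewrite inE /finite_norm unlock /= poweR_lty//.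
rewrite (_ : (\int[mu]_x _)%E = (\int[mu]_x (f x * f x)%:E)%E)//.
apply: eq_integral => x _ /=.
by rewrite powR_mulrn// -normrX expr2 ger0_norm// -expr2 sqr_ge0.
Qed.

Lemma L2_bounded f (M : R) : measurable_fun setT f ->
  (forall x, `|f x| <= M) -> L2 f.
Proof.
move=> mf fM; apply: L2_of_sqr => //.
apply: (@le_lt_trans _ _ (\int[mu]_x (M ^+ 2)%:E)%E).
  apply: ge0_le_integral => //.
  - by move=> x _; rewrite lee_fin -expr2 sqr_ge0.
  - by apply/measurable_EFinP; exact: measurable_funM.
  - move=> x _; rewrite lee_fin -expr2 -real_normK ?num_real//.
    by rewrite ler_pXn2r ?nnegrE// (le_trans _ (fM x)).
rewrite integral_cst// lte_mul_pinfty// ?lee_fin ?sqr_ge0//.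
by rewrite -ge0_fin_numE//; exact: fin_num_measure.
Qed.

Lemma L2_norm f : L2 f -> L2 (fun x => `|f x|).
Proof.
move=> hf; apply: L2_of_sqr.
  by apply: measurableT_comp => //; exact: L2_measurable hf.
under eq_integral do rewrite -expr2 real_normK ?num_real// expr2.
by rewrite -ipE// ltry.
Qed.

Lemma Rintegral_norm_le f : L2 f ->
  \int[mu]_x `|f x| <= Num.sqrt (ip mu f f) * Num.sqrt (ip mu (cst 1) (cst 1)).
Proof.
move=> hf; rewrite -ip_cst1; last exact: L2_norm.
have -> : ip mu f f = ip mu (fun x => `|f x|) (fun x => `|f x|).
  by apply: eq_Rintegral => x _; rewrite -!expr2 real_normK ?num_real.
apply: le_trans (ler_norm _) _; apply: ip_cauchy; first exact: L2_norm.
exact: Lfun_cst.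
Qed.

(** A sequence that is Cauchy in L^2 fast enough converges almost everywhere:
    the series of its increments is dominated in L^1 by a geometric series. *)
Lemma ae_cvg_fast G : (forall j, L2 (G j)) ->
  (forall j, ip mu (fun x => G j.+1 x - G j x) (fun x => G j.+1 x - G j x)
             <= (4^-1) ^+ j) ->
  {ae mu, forall x, cvgn (fun j => G j x)}.
Proof.
move=> hG fast; pose D j x := G j.+1 x - G j x.
have hD j : L2 (D j) by exact: L2B.
have hN j : L2 (fun x => `|D j x|) by exact: L2_norm.
pose C := Num.sqrt (ip mu (cst 1) (cst 1)).
have C0 : 0 <= C by exact: sqrtr_ge0.
have Dle j : \int[mu]_x `|D j x| <= C * 2^-1 ^+ j.
  apply: le_trans (Rintegral_norm_le (hD j)) _; rewrite mulrC ler_wpM2l//.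
  rewrite -[leRHS]ger0_norm ?exprn_ge0// -sqrtr_sqr ler_sqrt ?sqr_ge0//.
  by rewrite exprAC (_ : 2^-1 ^+ 2 = 4^-1 :> R) ?fast//; lra.
have iDE j : (\int[mu]_x `|D j x|%:E)%E = (\int[mu]_x `|D j x|)%:E.
  by rewrite fineK//; apply: integrable_fin_num => //; exact: L2_integrable (hN j).
have mH j : measurable_fun setT (fun x => `|D j x|%:E).
  by apply/measurable_EFinP; exact: L2_measurable (hN j).
have H_lty : (\int[mu]_x \sum_(0 <= j <oo) `|D j x|%:E < +oo)%E.
  rewrite integral_nneseries//.
  apply: (@le_lt_trans _ _ (2 * C)%:E); last exact: ltry.
  apply: lime_le.
    by apply: is_cvg_nneseries => j _ _; apply: integral_ge0 => x _; rewrite lee_fin.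
  apply: nearW => m; under eq_bigr do rewrite iDE.
  rewrite sumEFin lee_fin.
  apply: (@le_trans _ _ (\sum_(0 <= j < m) C * 2^-1 ^+ j)).
    by apply: ler_sum => j _; exact: Dle.
  have -> : \sum_(0 <= j < m) C * 2^-1 ^+ j = 2 * C * (1 - 2^-1 ^+ m).
    elim: m => [|m IH]; first by rewrite big_nil expr0 subrr mulr0.
    by rewrite big_nat_recr//= IH exprS; lra.
  by rewrite mulrBr mulr1 lerBlDr lerDl !mulr_ge0// exprn_ge0.
have : mu.-integrable setT (fun x => \sum_(0 <= j <oo) `|D j x|%:E)%E.
  apply/integrableP; split.
    by apply: ge0_emeasurable_sum => // j x _ _; rewrite lee_fin.
  by under eq_integral do rewrite gee0_abs ?nneseries_ge0//.
move=> /(integrable_ae measurableT); apply: filterS => x /(_ I) fx.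
have : cvgn [normed series (fun j => D j x)].
  apply: nnseries_is_cvg; first by move=> j; exact: normr_ge0.
  rewrite -ge0_fin_numE; first exact: fx.
  by apply: nneseries_ge0 => j _ _; rewrite lee_fin; exact: normr_ge0.
move=> /normed_cvg cD.
have -> : (fun j => G j x) = (fun j => G 0%N x + series (telescope (fun j => G j x)) j).
  by apply/funext => j; rewrite -eq_sum_telescope.
exact: is_cvgD (is_cvg_cst _) cD.
Qed.

(** A subsequence converges almost everywhere by [ae_cvg_fast]; Fatou's lemma turns
    the Cauchy condition into convergence in norm to its pointwise limit. *)
Lemma Riesz_Fischer F : (forall N, L2 (F N)) ->
  (forall e, 0 < e -> exists N0, forall N M, (N0 <= N)%N -> (N0 <= M)%N ->
     ip mu (fun x => F N x - F M x) (fun x => F N x - F M x) <= e) ->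
  exists2 f, L2 f & cvgL2 mu F f.
Proof.
move=> hF cF.
have /choice[s sP] : forall j, exists N0, forall N M, (N0 <= N)%N -> (N0 <= M)%N ->
     ip mu (fun x => F N x - F M x) (fun x => F N x - F M x) <= (4^-1) ^+ j.
  by move=> j; apply: cF; rewrite exprn_gt0.
(* r j dominates s 0, ..., s j, so both r j and r (j + 1) lie beyond s j; the
   summand j makes r tend to infinity *)
pose r j := (\max_(i < j.+1) s i + j)%N.
have sr i j : (i <= j)%N -> (s i <= r j)%N.
  move=> ij; rewrite (leq_trans _ (leq_addr _ _))//.
  exact: (@leq_bigmax_cond _ xpredT (fun i : 'I_j.+1 => s i) (Ordinal (ij : (i < j.+1)%N))).
pose G j := F (r j).
have hG j : L2 (G j) by exact: hF.
have aeG : {ae mu, forall x, cvgn (fun j => G j x)}.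
  by apply: ae_cvg_fast => // j; apply: sP; exact: sr.
(* a limit superior is a measurable choice of the limit, also off the good set *)
pose w x := fine (limn_esup (fun j => (G j x)%:E)).
have mw : measurable_fun setT w.
  apply: measurableT_comp => //; apply: measurable_fun_limn_esup => j.
  by apply/measurable_EFinP; exact: L2_measurable (hG j).
have Gw : {ae mu, forall x, G j x @[j --> \oo] --> w x}.
  apply: filterS aeG => x cG.
  have := @cvg_limn_einf_sup _ (fun j => (G j x)%:E) (limn (fun j => G j x))%:E.
  move=> [|_ E]; first by apply: cvg_EFin; [exact: nearW|exact: cG].
  by rewrite /w E.
have key N e : (exists j0, forall j, (j0 <= j)%N ->
      ip mu (fun x => F N x - G j x) (fun x => F N x - G j x) <= e) ->
    (\int[mu]_x ((F N x - w x) * (F N x - w x))%:E <= e%:E)%E.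
  move=> [j0 hj0]; pose h j x := ((F N x - G j x) * (F N x - G j x))%:E.
  have mh j : measurable_fun setT (h j).
    apply/measurable_EFinP; have m := L2_measurable (L2B (hF N) (hG j)).
    exact: measurable_funM.
  rewrite (ae_eq_integral (fun x => limn_einf (h ^~ x)))//; last 3 first.
  - apply/measurable_EFinP; have m : measurable_fun setT (fun x => F N x - w x).
      by apply: measurable_funB => //; exact: L2_measurable (hF N).
    exact: measurable_funM.
  - rewrite (_ : (fun x => _) = (fun x => - limn_esup (fun j => - h j x))%E).
      apply: measurableT_comp => //; apply: measurable_fun_limn_esup => j.
      exact: measurableT_comp.
    by apply/funext => x; rewrite (limn_esupN (h ^~ x)) oppeK.
  - apply: filterS Gw => x Gx _; apply/esym.
    have [] := @cvg_limn_einf_sup _ (h ^~ x) ((F N x - w x) * (F N x - w x))%:E => //.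
    apply: cvg_EFin; first exact: nearW.
    by apply: cvgM; apply: cvgB => //; exact: cvg_cst.
  apply: le_trans (fatou _ _ _ _) _ => //.
    by move=> j x _; rewrite lee_fin -expr2 sqr_ge0.
  rewrite limn_einf_lim; apply: lime_le; first exact: is_cvg_einfs.
  apply: nearW => m; apply: (@le_trans _ _ (\int[mu]_x h (maxn m j0) x)%E).
    apply: ereal_inf_lbound; exists (maxn m j0) => //=; exact: leq_maxl.
  rewrite -ipE ?lee_fin; [|exact: L2B..].
  by apply: hj0; exact: leq_maxr.
have close e : 0 < e -> exists N0, forall N, (N0 <= N)%N ->
    (\int[mu]_x ((F N x - w x) * (F N x - w x))%:E <= e%:E)%E.
  move=> e0; have [N0 hN0] := cF e e0; exists N0 => N hN; apply: key; exists N0 => j hj.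
  by apply: hN0 => //; rewrite (leq_trans hj)// leq_addl.
have hw : L2 w.
  have [N0 /(_ N0 (leqnn _)) hN] := close 1 ltr01.
  have hFw : L2 (fun x => F N0 x - w x).
    apply: L2_of_sqr; last exact: le_lt_trans hN (ltry _).
    by apply: measurable_funB => //; exact: L2_measurable (hF N0).
  have -> : w = (fun x => F N0 x - (F N0 x - w x)) by apply/funext => x; rewrite subKr.
  exact: L2B.
exists w => //; apply/cvgrPdist_le => e e0; have [N0 hN0] := close e e0.
near=> N; rewrite sub0r normrN ger0_norm ?ip_ge0//.
rewrite -lee_fin ipE; [|exact: L2B..]; apply: hN0; near: N; exact: nbhs_infty_ge.
Unshelve. all: by end_near. Qed.

End Riesz_Fischer.

(** * Orthogonality of the trigonometric system *)
Section circle.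
Variable R : realType.

(** The complement of the interval is a null set of [circle_measure]. *)
Lemma Rintegral_circle (f : R -> R) : measurable_fun setT f ->
    (exists M, forall x, `|f x| <= M) ->
  \int[circle_measure R]_x f x =
  \int[@lebesgue_measure R]_(x in `[0, pi *+ 2]) f x.
Proof.
move=> mf [M fM]; pose D := [set` `[0 : R, pi *+ 2]].
have mD : measurable (D : set (measurableTypeR R)) by exact: measurable_itv.
have hf := @L2_bounded _ (measurableTypeR R) R (circle_measure R) f M mf fM.
have H : (circle_measure R) (~` D) = 0%E.
  by rewrite /circle_measure /= /mfrestr /mrestr setICl measure0.
have := negligible_integral (measurableC mD) measurableT (L2_integrable hf) H.
rewrite /Rintegral setTD setCK => /= ->.
congr fine; apply: eq_measure_integral => A mA AD.
by rewrite /circle_measure /= /mfrestr /mrestr setIidl.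
Qed.

Lemma Rintegral_circle_FTC (f F : R -> R) :
    (forall x : R, is_derive x 1 F (f x)) -> continuous f ->
    (exists M, forall x, `|f x| <= M) ->
  \int[circle_measure R]_x f x = F (pi *+ 2) - F 0.
Proof.
move=> dF cf fM; have cF : continuous F.
  by move=> x; apply/differentiable_continuous/derivable1_diffP; have [] := dF x.
rewrite Rintegral_circle//; last exact: continuous_measurable_fun.
rewrite /Rintegral (@continuous_FTC2 _ f F)//.
- by rewrite mulrn_wgt0// pi_gt0.
- by apply: continuous_subspaceT.
- split; first by move=> x _; have [] := dF x.
  + exact: cvg_at_right_filter (cF 0).
  + exact: cvg_at_left_filter (cF (pi *+ 2)).
- by move=> x _; rewrite derive1E; have [] := dF x.
Qed.

Lemma sin_2pi_int (k : int) : sin (k%:~R * (pi *+ 2)) = 0 :> R.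
Proof.
have H (j : nat) : sin (j%:R * (pi *+ 2)) = 0 :> R.
  by rewrite mulr_natl -[_ *+ j]add0r periodicn ?sin0//; exact: sinD2pi.
case: k => j; first exact: H.
by rewrite NegzE mulrNz mulNr sinN; rewrite -pmulrn H oppr0.
Qed.

Lemma cos_2pi_int (k : int) : cos (k%:~R * (pi *+ 2)) = 1 :> R.
Proof.
have H (j : nat) : cos (j%:R * (pi *+ 2)) = 1 :> R.
  by rewrite mulr_natl -[_ *+ j]add0r periodicn ?cos0//; exact: cosD2pi.
case: k => j; first exact: H.
by rewrite NegzE mulrNz mulNr cosN; rewrite -pmulrn H.
Qed.

Lemma circle_cos (k : int) :
  \int[circle_measure R]_x cos (k%:~R * x) = if k == 0 then pi *+ 2 else 0.
Proof.
have cc : continuous (fun x : R => cos (k%:~R * x)).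
  move=> x; apply: continuous_comp; last exact: continuous_cos.
  by apply: cvgM; [exact: cvg_cst|exact: cvg_id].
have bc : exists M : R, forall x : R, `|cos (k%:~R * x)| <= M.
  by exists 1 => x; rewrite ler_norml cos_geN1 cos_le1.
case: eqP => [k0|/eqP k0].
  have dF (x : R) : is_derive x 1 id (cos (k%:~R * x)).
    by rewrite k0 mul0r cos0; exact: is_derive_id.
  by rewrite (Rintegral_circle_FTC dF cc bc) subr0.
have k0' : k%:~R != 0 :> R by rewrite intr_eq0.
have dF (x : R) : is_derive x 1 (fun x => k%:~R^-1 * sin (k%:~R * x)) (cos (k%:~R * x)).
  apply: is_derive_eq.
  by rewrite /GRing.scale /=; field.
by rewrite (Rintegral_circle_FTC dF cc bc) sin_2pi_int !mulr0 sin0 mulr0 subrr.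
Qed.

Lemma circle_sin (k : int) : \int[circle_measure R]_x sin (k%:~R * x) = 0.
Proof.
case: (eqVneq k 0) => [->|k0].
  under eq_Rintegral do rewrite mul0r sin0.
  by rewrite Rintegral_cst// mul0r.
have cc : continuous (fun x : R => sin (k%:~R * x)).
  move=> x; apply: continuous_comp; last exact: continuous_sin.
  by apply: cvgM; [exact: cvg_cst|exact: cvg_id].
have bc : exists M : R, forall x : R, `|sin (k%:~R * x)| <= M.
  by exists 1 => x; rewrite ler_norml sin_geN1 sin_le1.
have k0' : k%:~R != 0 :> R by rewrite intr_eq0.
have dF (x : R) : is_derive x 1 (fun x => - k%:~R^-1 * cos (k%:~R * x)) (sin (k%:~R * x)).
  apply: is_derive_eq.
  by rewrite /GRing.scale /=; field.
by rewrite (Rintegral_circle_FTC dF cc bc) cos_2pi_int !mulr0 cos0 subrr.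
Qed.

End circle.

Section torus.
Variable R : realType.

Lemma phase_measurable n (m : freq n) : measurable_fun setT (@phase R n m).
Proof.
apply: measurable_sum => i.
by apply: measurable_funM => //; exact: measurable_tnth.
Qed.

Lemma cos_phase_measurable n (m : freq n) :
  measurable_fun setT (fun x => cos (@phase R n m x)).
Proof.
apply: measurableT_comp; last exact: phase_measurable.
by apply: continuous_measurable_fun; exact: continuous_cos.
Qed.

Lemma sin_phase_measurable n (m : freq n) :
  measurable_fun setT (fun x => sin (@phase R n m x)).
Proof.
apply: measurableT_comp; last exact: phase_measurable.
by apply: continuous_measurable_fun; exact: continuous_sin.
Qed.

Lemma L2_cos n (m : freq n) :
  (fun x => cos (phase m x)) \in Lfun (torus_measure R n) 2%:E.
Proof.
apply: (@L2_bounded _ _ _ _ _ 1); first exact: cos_phase_measurable.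
by move=> x; rewrite ler_norml cos_geN1 cos_le1.
Qed.

Lemma L2_sin n (m : freq n) :
  (fun x => sin (phase m x)) \in Lfun (torus_measure R n) 2%:E.
Proof.
apply: (@L2_bounded _ _ _ _ _ 1); first exact: sin_phase_measurable.
by move=> x; rewrite ler_norml sin_geN1 sin_le1.
Qed.

(** Fubini's theorem for one step in the recursive construction of
    [torus_measure]; a bound on [f] ensures integrability on every slice. *)
Lemma Rintegral_torusS n (f : tpoint R n.+1 -> R) (M : R) :
    measurable_fun setT f -> (forall x, `|f x| <= M) ->
  \int[torus_measure R n.+1]_x f x =
  \int[circle_measure R]_a \int[torus_measure R n]_y f (tcons (a, y)).
Proof.
move=> mf fM.
have mg : measurable_fun setT (f \o @tcons R n).
  by apply: measurableT_comp => //; exact: measurable_tcons.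
have fin_cons a : (\int[torus_measure R n]_y (f (tcons (a, y)))%:E =
    (\int[torus_measure R n]_y f (tcons (a, y)))%:E)%E.
  rewrite /Rintegral fineK//; apply: integrable_fin_num => //.
  apply: L2_integrable; apply: (@L2_bounded _ _ _ _ _ M) => //.
  exact: (measurableT_comp mg (pair1_measurable a)).
have ig : ((circle_measure R) \x (torus_measure R n))%E.-integrable setT
    (EFin \o (f \o @tcons R n)).
  apply: measurable_bounded_integrable => //.
  - have -> : [set: measurableTypeR R * tpoint R n] =
        [set: measurableTypeR R] `*` [set: tpoint R n] by rewrite setXTT.
    apply: (@le_lt_trans _ _ (circle_measure R setT * torus_measure R n setT)%E).
      by rewrite -product_measure1E.
    by rewrite lte_mul_pinfty// -?ge0_fin_numE// fin_num_measure.
  - exists M; split; first exact: num_real.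
    by move=> x Mx y _ /=; apply: le_trans (ltW Mx).
rewrite {1}/Rintegral /=.
rewrite [X in fine X](_ : _ =
   (\int[pushforward ((circle_measure R) \x (torus_measure R n)) (@tcons R n)]_x (f x)%:E)%E)//.
rewrite integral_pushforward//; last 2 first.
- exact: measurable_tcons.
- exact/measurable_EFinP.
rewrite preimage_setT -integral12_prod_meas1//.
by congr fine; apply: eq_integral => a _; rewrite -fin_cons.
Qed.

Definition ftail n (m : freq n.+1) : freq n := [ffun i => m (lift ord0 i)].

Lemma phase_tcons n (m : freq n.+1) a (y : tpoint R n) :
  phase m (tcons (a, y)) = (m ord0)%:~R * a + phase (ftail m) y.
Proof.
rewrite /phase big_ord_recl; congr (_ + _).
by apply: eq_bigr => i _; rewrite ffunE /tcons /= tnthS.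
Qed.

(** The phase is additive in the coordinates: by the addition formulas both
    integrals factor through [Rintegral_torusS]. Both are needed for the induction. *)
Lemma torus_cos_sin n (m : freq n) :
  \int[torus_measure R n]_x cos (phase m x) =
    (if m == [ffun=> 0] then (pi *+ 2) ^+ n else 0) /\
  \int[torus_measure R n]_x sin (phase m x) = 0.
Proof.
elim: n m => [|n IH] m.
  have ph x : @phase R 0 m x = 0 by rewrite /phase big_ord0.
  have -> : m == [ffun=> 0] by apply/eqP/ffunP => -[].
  under eq_Rintegral do rewrite ph cos0.
  under [in X in _ /\ X]eq_Rintegral do rewrite ph sin0.
  rewrite !Rintegral_cst// mul0r expr0 mul1r; split => //.
  by rewrite /= /dirac indicE in_setT.
have m0E : (m == [ffun=> 0]) = (m ord0 == 0) && (ftail m == [ffun=> 0]).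
  apply/eqP/andP => [->|[/eqP m0 /eqP mt]].
    by split; rewrite ?ffunE//; apply/eqP/ffunP => i; rewrite !ffunE.
  apply/ffunP => i; rewrite ffunE; case: (unliftP ord0 i) => [j ->|->] //.
  by move/ffunP/(_ j): mt; rewrite !ffunE.
have [ICt ISt] := IH (ftail m).
have ic := L2_integrable (L2_cos (ftail m)); have is_ := L2_integrable (L2_sin (ftail m)).
have icZ c : (torus_measure R n).-integrable setT (EFin \o (fun x => c * cos (phase (ftail m) x))).
  by apply: L2_integrable; apply: L2Z; exact: L2_cos.
have isZ c : (torus_measure R n).-integrable setT (EFin \o (fun x => c * sin (phase (ftail m) x))).
  by apply: L2_integrable; apply: L2Z; exact: L2_sin.
have mid (k : int) : measurable_fun setT (fun a : measurableTypeR R => k%:~R * a : R).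
  exact: measurable_funM.
have mc (k : int) : measurable_fun setT (fun a : measurableTypeR R => cos (k%:~R * a)).
  by apply: measurableT_comp (mid k); apply: continuous_measurable_fun; exact: continuous_cos.
have ms (k : int) : measurable_fun setT (fun a : measurableTypeR R => sin (k%:~R * a)).
  by apply: measurableT_comp (mid k); apply: continuous_measurable_fun; exact: continuous_sin.
split.
  rewrite (@Rintegral_torusS _ _ 1); first last.
  - by move=> x; rewrite ler_norml cos_geN1 cos_le1.
  - exact: cos_phase_measurable.
  rewrite (@eq_Rintegral _ (measurableTypeR R) R _ _ (fun a : R => cos ((m ord0)%:~R * a) *
      \int[torus_measure R n]_y cos (phase (ftail m) y))); last first.
    move=> a _; under eq_Rintegral do rewrite phase_tcons cosD.
    by rewrite RintegralB// !RintegralZl// ISt mulr0 subr0.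
  rewrite RintegralZr//; last first.
    have := L2_integrable (@L2_bounded _ (measurableTypeR R) _ (circle_measure R) _ 1 (mc (m ord0)) _).
    by apply => x; rewrite ler_norml cos_geN1 cos_le1.
  rewrite circle_cos ICt m0E; case: (m ord0 == 0) => /=; last by rewrite mul0r.
  by case: ifP; rewrite ?mulr0// exprS.
rewrite (@Rintegral_torusS _ _ 1); first last.
- by move=> x; rewrite ler_norml sin_geN1 sin_le1.
- exact: sin_phase_measurable.
rewrite (@eq_Rintegral _ (measurableTypeR R) R _ _ (fun a : R => sin ((m ord0)%:~R * a) *
    \int[torus_measure R n]_y cos (phase (ftail m) y))); last first.
  move=> a _; under eq_Rintegral do rewrite phase_tcons sinD.
  by rewrite RintegralD// !RintegralZl// ISt mulr0 addr0.
rewrite RintegralZr//; last first.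
  have := L2_integrable (@L2_bounded _ (measurableTypeR R) _ (circle_measure R) _ 1 (ms (m ord0)) _).
  by apply => x; rewrite ler_norml sin_geN1 sin_le1.
by rewrite circle_sin mul0r.
Qed.

End torus.

Section frequencies.
Variable n : nat.
Implicit Types m : freq n.

(** The range of the partial Fourier sums as a duplicate-free list, so that sums
    over different boxes can be compared. *)
Definition box N : seq (freq n) :=
  [seq box_freq q | q : {ffun 'I_n -> 'I_(N.*2.+1)}].

Lemma box_uniq N : uniq (box N).
Proof.
rewrite map_inj_uniq ?enum_uniq// => p q /ffunP pq; apply/ffunP => i.
by have := pq i; rewrite !ffunE => /addIr[] /ord_inj.
Qed.

Lemma mem_box N m : (m \in box N) = [forall i, (`|m i| <= N)%N].
Proof.
apply/mapP/forallP => [[q _ ->] i|mN].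
  by rewrite ffunE; case: (q i) => j /=; rewrite -muln2; lia.
have h i : (`|(m i + N%:Z)%R|%N < N.*2.+1)%N by have := mN i; rewrite -muln2; lia.
exists [ffun i => Ordinal (h i)]; first by rewrite mem_enum.
by apply/ffunP => i; rewrite !ffunE /= gez0_abs ?addrK//; have := mN i; lia.
Qed.

Lemma box_opp N m : (- m \in box N) = (m \in box N).
Proof. by rewrite !mem_box; apply: eq_forallb => i; rewrite ffunE abszN. Qed.

Lemma mem_box_le N M m : (N <= M)%N -> m \in box N -> m \in box M.
Proof.
by rewrite !mem_box => NM /forallP H; apply/forallP => i; exact: leq_trans NM.
Qed.

Lemma mem_box_ex m : exists N, m \in box N.
Proof.
exists (\max_i `|m i|)%N; rewrite mem_box; apply/forallP => i.
exact: leq_bigmax.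
Qed.

Lemma box_sub_perm N M : (N <= M)%N -> perm_eq [seq m <- box M | m \in box N] (box N).
Proof.
move=> NM; apply: uniq_perm; rewrite ?filter_uniq ?box_uniq// => m.
rewrite mem_filter; apply/andP/idP => [[]//|mN]; split => //; exact: mem_box_le mN.
Qed.

(** A smaller box is a condition on a larger one. *)
Lemma box_sum_le (V : nmodType) N M (f : freq n -> V) : (N <= M)%N ->
  \sum_(m <- box N) f m = \sum_(m <- box M | m \in box N) f m.
Proof. by move=> NM; rewrite -(perm_big _ (box_sub_perm NM)) big_filter. Qed.

Lemma box_sum1 (V : pzSemiRingType) N (f : freq n -> V) p :
  \sum_(m <- box N) f m * (m == p)%:R = if p \in box N then f p else 0.
Proof.
rewrite (eq_bigr (fun m => if m == p then f m else 0)); last first.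
  by move=> m _; case: eqP; rewrite ?mulr1 ?mulr0.
rewrite -big_mkcond; case: ifP => pN; first by rewrite -big_filter filter_pred1_uniq ?box_uniq// big_seq1.
by rewrite big_seq_cond big1// => m /andP[mN /eqP E]; rewrite -E mN in pN.
Qed.

End frequencies.

Section trigonometric_polynomials.
Variables (R : realType) (n : nat).
Implicit Types (m p : freq n) (a b : freq n -> R).
Local Notation mu := (torus_measure R n).
Local Notation ip := (ip mu).

Definition vol : R := (pi *+ 2) ^+ n.

Lemma vol_gt0 : 0 < vol.
Proof. by rewrite exprn_gt0// mulrn_wgt0// pi_gt0. Qed.

Definition cosf m : tpoint R n -> R := fun x => cos (phase m x).
Definition sinf m : tpoint R n -> R := fun x => sin (phase m x).

Lemma phaseD m p (x : tpoint R n) : phase (m + p) x = phase m x + phase p x.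
Proof. by rewrite -big_split; apply: eq_bigr => i _; rewrite ffunE intrD mulrDl. Qed.

Lemma phaseN m (x : tpoint R n) : phase (- m) x = - phase m x.
Proof. by rewrite -sumrN; apply: eq_bigr => i _; rewrite ffunE intrN mulNr. Qed.

Lemma int_cosf m : \int[mu]_x cosf m x = vol * (m == 0)%:R.
Proof.
rewrite (torus_cos_sin R m).1 (_ : [ffun=> 0] = 0); last by apply/ffunP => i; rewrite !ffunE.
by case: eqP; rewrite ?mulr1 ?mulr0.
Qed.

Lemma int_sinf m : \int[mu]_x sinf m x = 0.
Proof. exact: (torus_cos_sin R m).2. Qed.

Lemma ip_cos_cos m p : ip (cosf m) (cosf p) = vol / 2 * ((m == p)%:R + (m == - p)%:R).
Proof.
have E x : cosf m x * cosf p x = 2^-1 * cosf (m - p) x + 2^-1 * cosf (m + p) x.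
  by rewrite /cosf !phaseD phaseN !cosD cosN sinN; field.
rewrite /ip; under eq_Rintegral do rewrite E.
rewrite RintegralD//; try by apply: L2_integrable; apply: L2Z; exact: L2_cos.
rewrite !RintegralZl//; try by apply: L2_integrable; exact: L2_cos.
by rewrite !int_cosf subr_eq0 addr_eq0; ring.
Qed.

Lemma ip_sin_sin m p : ip (sinf m) (sinf p) = vol / 2 * ((m == p)%:R - (m == - p)%:R).
Proof.
have E x : sinf m x * sinf p x = 2^-1 * cosf (m - p) x - 2^-1 * cosf (m + p) x.
  by rewrite /cosf /sinf !phaseD phaseN !cosD cosN sinN; field.
rewrite /ip; under eq_Rintegral do rewrite E.
rewrite RintegralB//; try by apply: L2_integrable; apply: L2Z; exact: L2_cos.
rewrite !RintegralZl//; try by apply: L2_integrable; exact: L2_cos.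
by rewrite !int_cosf subr_eq0 addr_eq0; ring.
Qed.

Lemma ip_sin_cos m p : ip (sinf m) (cosf p) = 0.
Proof.
have E x : sinf m x * cosf p x = 2^-1 * sinf (m - p) x + 2^-1 * sinf (m + p) x.
  by rewrite /cosf /sinf !phaseD phaseN !sinD cosN sinN; field.
rewrite /ip; under eq_Rintegral do rewrite E.
rewrite RintegralD//; try by apply: L2_integrable; apply: L2Z; exact: L2_sin.
rewrite !RintegralZl//; try by apply: L2_integrable; exact: L2_sin.
by rewrite !int_sinf !mulr0 addr0.
Qed.

Definition trig N a b (x : tpoint R n) : R :=
  \sum_(m <- box n N) (a m * cosf m x + b m * sinf m x).

(** With complex coefficients a - i b: the coefficient at - m is the conjugate of
    the one at m, which characterises the Fourier coefficients of real functions. *)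
Definition conj_sym a b : Prop :=
  (forall m, a (- m) = a m) /\ (forall m, b (- m) = - b m).

Lemma L2_trig_term a b m : (fun x => a m * cosf m x + b m * sinf m x) \in Lfun mu 2%:E.
Proof. by apply: L2D; apply: L2Z; [exact: L2_cos|exact: L2_sin]. Qed.

Lemma L2_trig N a b : trig N a b \in Lfun mu 2%:E.
Proof. by apply: L2_sum => m; exact: L2_trig_term. Qed.

(** The frequencies p and - p contribute equally, by symmetry; hence the factor 1/2
    in [ip_cos_cos] disappears. *)
Lemma ip_trig_cos N a b p : conj_sym a b ->
  ip (trig N a b) (cosf p) = vol * (if p \in box n N then a p else 0).
Proof.
move=> [sa sb]; rewrite ip_suml; [|by move=> m; exact: L2_trig_term|exact: L2_cos].
under eq_bigr => m _.
  rewrite ipDl; [|by apply: L2Z; exact: L2_cos|by apply: L2Z; exact: L2_sin|exact: L2_cos].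
  rewrite !ipZl; [|exact: L2_sin|exact: L2_cos|exact: L2_cos|exact: L2_cos].
  rewrite ip_sin_cos ip_cos_cos mulr0 addr0.
  rewrite (_ : _ * _ = vol / 2 * (a m * (m == p)%:R + a m * (m == - p)%:R)); last by ring.
  over.
rewrite -mulr_sumr big_split /= !box_sum1 box_opp sa; case: ifP => _; by field.
Qed.

Lemma ip_trig_sin N a b p : conj_sym a b ->
  ip (trig N a b) (sinf p) = vol * (if p \in box n N then b p else 0).
Proof.
move=> [sa sb]; rewrite ip_suml; [|by move=> m; exact: L2_trig_term|exact: L2_sin].
under eq_bigr => m _.
  rewrite ipDl; [|by apply: L2Z; exact: L2_cos|by apply: L2Z; exact: L2_sin|exact: L2_sin].
  rewrite !ipZl; [|exact: L2_sin|exact: L2_sin|exact: L2_cos|exact: L2_sin].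
  rewrite ip_sin_sin ipC ip_sin_cos mulr0 add0r.
  rewrite (_ : _ * _ = vol / 2 * (b m * (m == p)%:R - b m * (m == - p)%:R)); last by ring.
  over.
rewrite -mulr_sumr sumrB /= !box_sum1 box_opp sb; case: ifP => _; by field.
Qed.

Lemma ip_trig N a b a' b' : conj_sym a b ->
  ip (trig N a b) (trig N a' b') =
  vol * \sum_(m <- box n N) (a m * a' m + b m * b' m).
Proof.
move=> s; rewrite ipC ip_suml; [|by move=> m; exact: L2_trig_term|exact: L2_trig].
rewrite mulr_sumr !big_seq; apply: eq_bigr => m mN.
rewrite ipDl; [|by apply: L2Z; exact: L2_cos|by apply: L2Z; exact: L2_sin|exact: L2_trig].
rewrite !ipZl; [|exact: L2_sin|exact: L2_trig|exact: L2_cos|exact: L2_trig].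
by rewrite ![ip _ (trig _ _ _)]ipC ip_trig_cos// ip_trig_sin// mN; ring.
Qed.

End trigonometric_polynomials.

(** * Fourier series in L^2 *)
Section cvgL2_algebra.
Context d (T : measurableType d) (R : realType).
Variable mu : {finite_measure set T -> \bar R}.
Implicit Types (f g : T -> R) (F G : nat -> T -> R).
Local Notation L2 f := (f \in Lfun mu 2%:E).

Lemma cvgL2_cst f : cvgL2 mu (fun=> f) f.
Proof.
rewrite /cvgL2 (_ : (fun _ => _) = cst 0); first exact: cvg_cst.
apply/funext => N; rewrite /ip; under eq_Rintegral do rewrite subrr mul0r.
by rewrite Rintegral_cst// mul0r.
Qed.

Lemma ip_sqrD f g : L2 f -> L2 g ->
  ip mu (fun x => f x + g x) (fun x => f x + g x) = ip mu f f + 2 * ip mu f g + ip mu g g.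
Proof.
move=> hf hg; have hS := L2D hf hg.
by rewrite ipDl// ![ip mu _ (fun x => _ + _)]ipC !ipDl// [ip mu g f]ipC; ring.
Qed.

Lemma cvgL2D F G f g : (forall N, L2 (F N)) -> L2 f ->
    (forall N, L2 (G N)) -> L2 g -> cvgL2 mu F f -> cvgL2 mu G g ->
  cvgL2 mu (fun N x => F N x + G N x) (fun x => f x + g x).
Proof.
move=> hF hf hG hg Ff Gg.
have hFf N := L2B (hF N) hf; have hGg N := L2B (hG N) hg.
have L20 : L2 (cst 0) by exact: Lfun_cst.
have to0 H h : cvgL2 mu H h -> cvgL2 mu (fun N x => H N x - h x) (cst 0).
  move=> c; rewrite /cvgL2 (_ : (fun N => ip _ _ _) =
    (fun N => ip mu (fun x => H N x - h x) (fun x => H N x - h x)))//.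
  by apply/funext => N; congr ip; apply/funext => x; exact: subr0.
have cross : ip mu (fun x => F N x - f x) (fun x => G N x - g x) @[N --> \oo] --> 0.
  have := cvgL2_ip hFf L20 hGg L20 (to0 _ _ Ff) (to0 _ _ Gg).
  suff -> : ip mu (cst 0) (cst 0) = 0 by [].
  by rewrite /ip; under eq_Rintegral do rewrite mul0r; rewrite Rintegral_cst// mul0r.
rewrite /cvgL2 (_ : (fun N => ip mu _ _) = (fun N =>
   ip mu (fun x => F N x - f x) (fun x => F N x - f x)
   + 2 * ip mu (fun x => F N x - f x) (fun x => G N x - g x)
   + ip mu (fun x => G N x - g x) (fun x => G N x - g x))); last first.
  apply/funext => N.
  have E : (fun x => F N x + G N x - (f x + g x)) =
           (fun x => (F N x - f x) + (G N x - g x)) by apply/funext => x; ring.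
  by rewrite E ip_sqrD.
have E0 : 0 + 2 * 0 + 0 = 0 :> R by ring.
rewrite -[X in _ --> X]E0; apply: cvgD => //; apply: cvgD => //.
by apply: cvgM => //; exact: cvg_cst.
Qed.

End cvgL2_algebra.

Section Fourier_series.
Variables (R : realType) (n : nat).
Implicit Types (m p : freq n) (a b : freq n -> R) (u v w : tpoint R n -> R).
Local Notation mu := (torus_measure R n).
Local Notation vol := (vol R n).
Local Notation L2 f := (f \in Lfun mu 2%:E).

Lemma vol_neq0 : vol != 0.
Proof. by rewrite gt_eqF// vol_gt0. Qed.

Lemma fourier_cosE u m : fourier_cos u m = vol^-1 * ip mu u (cosf m).
Proof. by []. Qed.

Lemma fourier_sinE u m : fourier_sin u m = vol^-1 * ip mu u (sinf m).
Proof. by []. Qed.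

Lemma fourier_sym u : L2 u -> conj_sym (fourier_cos u) (fourier_sin u).
Proof.
move=> hu; split=> m.
  rewrite !fourier_cosE; congr (_ * _); apply: eq_Rintegral => x _.
  by rewrite /cosf phaseN cosN.
rewrite !fourier_sinE -mulrN ![ip _ u _]ipC -ipNl//; last exact: L2_sin.
by congr (_ * _); apply: eq_Rintegral => x _; rewrite /sinf phaseN sinN.
Qed.

Lemma fourier_cosD u v m : L2 u -> L2 v ->
  fourier_cos (fun x => u x + v x) m = fourier_cos u m + fourier_cos v m.
Proof. by move=> hu hv; rewrite !fourier_cosE ipDl ?mulrDr//; exact: L2_cos. Qed.

Lemma fourier_sinD u v m : L2 u -> L2 v ->
  fourier_sin (fun x => u x + v x) m = fourier_sin u m + fourier_sin v m.
Proof. by move=> hu hv; rewrite !fourier_sinE ipDl ?mulrDr//; exact: L2_sin. Qed.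

Lemma fourier_cosZ c u m : L2 u ->
  fourier_cos (fun x => c * u x) m = c * fourier_cos u m.
Proof. by move=> hu; rewrite !fourier_cosE ipZl; [rewrite mulrCA | done | exact: L2_cos]. Qed.

Lemma fourier_sinZ c u m : L2 u ->
  fourier_sin (fun x => c * u x) m = c * fourier_sin u m.
Proof. by move=> hu; rewrite !fourier_sinE ipZl; [rewrite mulrCA | done | exact: L2_sin]. Qed.

Lemma fourier_cosB u v m : L2 u -> L2 v ->
  fourier_cos (fun x => u x - v x) m = fourier_cos u m - fourier_cos v m.
Proof. by move=> hu hv; rewrite !fourier_cosE ipBl ?mulrBr//; exact: L2_cos. Qed.

Lemma fourier_sinB u v m : L2 u -> L2 v ->
  fourier_sin (fun x => u x - v x) m = fourier_sin u m - fourier_sin v m.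
Proof. by move=> hu hv; rewrite !fourier_sinE ipBl ?mulrBr//; exact: L2_sin. Qed.

Lemma ip_ae u v f : L2 u -> L2 v -> L2 f -> {ae mu, forall x, u x = v x} ->
  ip mu u f = ip mu v f.
Proof.
move=> hu hv hf uv; rewrite /ip /Rintegral; congr fine.
apply: ae_eq_integral => //; last by apply: filterS uv => x -> _.
- by have := measurable_int _ (L2_integrableM hu hf).
- by have := measurable_int _ (L2_integrableM hv hf).
Qed.

Lemma fourier_cos_ae u v : L2 u -> L2 v -> {ae mu, forall x, u x = v x} ->
  fourier_cos u = fourier_cos v.
Proof.
move=> hu hv uv; apply/funext => m.
by rewrite !fourier_cosE (ip_ae hu hv _ uv)//; exact: L2_cos.
Qed.

Lemma fourier_sin_ae u v : L2 u -> L2 v -> {ae mu, forall x, u x = v x} ->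
  fourier_sin u = fourier_sin v.
Proof.
move=> hu hv uv; apply/funext => m.
by rewrite !fourier_sinE (ip_ae hu hv _ uv)//; exact: L2_sin.
Qed.

(** The form in which derivatives occur, by [is_partialE]: a limit in the norm of L^2
    along growing boxes. *)
Definition is_series a b w : Prop := L2 w /\ cvgL2 mu (fun N => trig N a b) w.

Lemma is_partialE i u w : is_partial i u w <->
  is_series (fun m => (m i)%:~R * fourier_sin u m)
            (fun m => - ((m i)%:~R * fourier_cos u m)) w.
Proof.
have E N : partial_of_fourier_sum N u i =
    trig N (fun m => (m i)%:~R * fourier_sin u m) (fun m => - ((m i)%:~R * fourier_cos u m)).
  apply/funext => x; rewrite /partial_of_fourier_sum /trig big_map big_enum /=.
  by apply: eq_bigr => q _; rewrite /cosf /sinf; ring.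
have key (hw : L2 w) : ('N[mu]_2%:E[EFin \o (fun x => partial_of_fourier_sum N u i x - w x)%R]
      @[N --> \oo] --> 0)%E <->
    cvgL2 mu (fun N => trig N (fun m => (m i)%:~R * fourier_sin u m)
                        (fun m => - ((m i)%:~R * fourier_cos u m))) w.
  rewrite -cvgL2P//; last by move=> N; exact: L2_trig.
  by under eq_fun do rewrite E.
by split=> -[hw cw]; split => //; apply/key.
Qed.

(** Taking the inner product with one mode is continuous, and on the partial sums it
    is eventually constant. *)
Lemma series_fourier a b w m : conj_sym a b -> is_series a b w ->
  fourier_cos w m = a m /\ fourier_sin w m = b m.
Proof.
move=> sab [hw cw]; have hT N : trig N a b \in Lfun mu 2%:E by exact: L2_trig.
have [N0 mN0] := mem_box_ex m.
have lim c f : L2 f -> (forall N, ip mu (trig N a b) f = vol * (if m \in box n N then c else 0)) ->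
    ip mu w f = vol * c.
  move=> hf E.
  have H := cvgL2_ip hT hw (fun=> hf) hf cw (cvgL2_cst _ _).
  apply: (cvg_unique _ H) => //.
  apply: cvg_near_cst; near=> N; rewrite E (mem_box_le _ mN0)//.
  by near: N; exact: nbhs_infty_ge.
split.
- rewrite fourier_cosE (lim (a m)) ?mulKf ?vol_neq0//; first exact: L2_cos.
  by move=> N; exact: ip_trig_cos.
- rewrite fourier_sinE (lim (b m)) ?mulKf ?vol_neq0//; first exact: L2_sin.
  by move=> N; exact: ip_trig_sin.
Unshelve. all: by end_near. Qed.

(** Parseval's identity: by continuity of the inner product it follows from
    [ip_trig]. *)
Lemma series_ip a b a' b' w w' : conj_sym a b ->
    is_series a b w -> is_series a' b' w' ->
  vol * \sum_(m <- box n N) (a m * a' m + b m * b' m) @[N --> \oo] --> ip mu w w'.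
Proof.
move=> sab [hw cw] [hw' cw'].
have := cvgL2_ip (fun N => L2_trig N a b) hw (fun N => L2_trig N a' b') hw' cw cw'.
by under eq_fun do rewrite ip_trig//.
Qed.

(** A difference of partial sums is again a trigonometric polynomial, so [ip_trig]
    computes its norm. *)
Lemma trigB N M a b (x : tpoint R n) : (M <= N)%N ->
  trig N a b x - trig M a b x =
  trig N (fun m => if m \in box n M then 0 else a m)
         (fun m => if m \in box n M then 0 else b m) x.
Proof.
move=> MN; rewrite /trig (box_sum_le _ MN) [X in _ - X]big_mkcond -sumrB.
by apply: eq_bigr => m _; case: ifP => _; ring.
Qed.

(** The squared distance of two partial sums is a difference of partial sums of the
    convergent series of squares, hence the partial sums are Cauchy in L^2. *)
Lemma series_exists a b C : conj_sym a b ->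
    (forall N, \sum_(m <- box n N) (a m ^+ 2 + b m ^+ 2) <= C) ->
  exists w, is_series a b w.
Proof.
move=> [sa sb] bd; pose S N := \sum_(m <- box n N) (a m ^+ 2 + b m ^+ 2).
have t0 m : 0 <= a m ^+ 2 + b m ^+ 2 by rewrite addr_ge0 ?sqr_ge0.
have Sle N M : (M <= N)%N -> S M <= S N.
  move=> MN; rewrite /S (box_sum_le _ MN) big_mkcond; apply: ler_sum => m _.
  by case: ifP.
have cS : cvgn S.
  apply: nondecreasing_is_cvgn; first by move=> M N /Sle.
  by exists C => _ [N _ <-]; exact: bd.
have D N M : (M <= N)%N ->
    ip mu (fun x => trig N a b x - trig M a b x) (fun x => trig N a b x - trig M a b x)
    = vol * (S N - S M).
  move=> MN; under [X in ip _ X X]eq_fun do rewrite trigB//.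
  rewrite ip_trig; last first.
    by split=> m; rewrite box_opp; case: ifP; rewrite ?sa ?sb// oppr0.
  rewrite /S (box_sum_le _ MN) [X in _ = _ * (_ - X)]big_mkcond -sumrB.
  by congr (_ * _); apply: eq_bigr => m _; case: ifP => _; ring.
have cF e : 0 < e -> exists N0, forall N M, (N0 <= N)%N -> (N0 <= M)%N ->
     ip mu (fun x => trig N a b x - trig M a b x) (fun x => trig N a b x - trig M a b x) <= e.
  move=> e0; have e20 : 0 < e / vol / 2 by rewrite !divr_gt0// vol_gt0.
  have /cvgrPdist_le/(_ _ e20)[N0 _ HN0] := cS.
  exists N0 => N M hN hM; have nN := HN0 _ hN; have nM := HN0 _ hM.
  have close : `|S N - S M| <= e / vol.
    rewrite (_ : S N - S M = (limn S - S M) - (limn S - S N)); last by ring.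
    by apply: le_trans (ler_normB _ _) _; rewrite [leRHS]splitr lerD.
  wlog MN : N M hN hM nN nM close / (M <= N)%N.
    move=> H; case: (leqP M N) => [MN|/ltnW NM]; first exact: H.
    have -> : ip mu (fun x => trig N a b x - trig M a b x) (fun x => trig N a b x - trig M a b x)
       = ip mu (fun x => trig M a b x - trig N a b x) (fun x => trig M a b x - trig N a b x).
      by apply: eq_Rintegral => x _; ring.
    by apply: H => //; rewrite distrC.
  rewrite D// mulrC -ler_pdivlMr ?vol_gt0//.
  exact: le_trans (ler_norm _) close.
have [w hw cw] := Riesz_Fischer (fun N => L2_trig N a b) cF.
by exists w.
Qed.

Lemma is_series_sum (a b : 'I_n -> freq n -> R) (w : 'I_n -> tpoint R n -> R) :
  (forall i, is_series (a i) (b i) (w i)) ->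
  is_series (fun m => \sum_(i < n) a i m) (fun m => \sum_(i < n) b i m)
            (fun x => \sum_(i < n) w i x).
Proof.
move=> H; elim: (index_enum _) => [|i s [IHw IHc]].
  under [X in is_series _ _ X]eq_fun do rewrite big_nil.
  split; first exact: Lfun_cst.
  rewrite (_ : (fun N => _) = (fun=> cst 0)); first exact: cvgL2_cst.
  apply/funext => N; apply/funext => x; rewrite /trig big1// => m _.
  by rewrite !big_nil !mul0r addr0.
have [hi ci] := H i.
under [X in is_series _ _ X]eq_fun do rewrite big_cons.
split; first exact: L2D.
rewrite (_ : (fun N => _) = (fun N x => trig N (a i) (b i) x +
   trig N (fun m => \sum_(j <- s) a j m) (fun m => \sum_(j <- s) b j m) x)); last first.
  apply/funext => N; apply/funext => x; rewrite /trig -big_split; apply: eq_bigr => m _ /=.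
  by rewrite !big_cons; ring.
by apply: cvgL2D => // N; exact: L2_trig.
Qed.

End Fourier_series.

(** * Sobolev spaces and derivatives *)
Lemma cvg_sumr (R : realType) (T : Type) (F : set_system T) (FF : Filter F)
    (I : Type) (s : seq I) (P : pred I) (f : I -> T -> R) (l : I -> R) :
  (forall i, P i -> f i x @[x --> F] --> l i) ->
  \sum_(i <- s | P i) f i x @[x --> F] --> \sum_(i <- s | P i) l i.
Proof. by move=> fl; apply: cvg_big => //; exact: add_continuous. Qed.

Section sobolev_spaces.
Variables (R : realType) (n : nat).
Implicit Types (m p : freq n) (a b : freq n -> R) (u v w f g : tpoint R n -> R) (i : 'I_n).
Local Notation mu := (torus_measure R n).
Local Notation vol := (vol R n).
Local Notation L2 f := (f \in Lfun mu 2%:E).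
Local Notation lam := (@freq_sqr R n).
Local Notation fc := (@fourier_cos R n).
Local Notation fs := (@fourier_sin R n).

Lemma lam_ge0 m : 0 <= lam m.
Proof. by apply: sumr_ge0 => i _; exact: sqr_ge0. Qed.

Lemma lam1_ge1 m : 1 <= 1 + lam m.
Proof. by rewrite lerDl lam_ge0. Qed.

Lemma sqr_le_lam i m : (m i)%:~R ^+ 2 <= lam m.
Proof.
by rewrite /freq_sqr (bigD1 i)//= lerDl; apply: sumr_ge0 => j _; exact: sqr_ge0.
Qed.

Lemma lamX_le j s m : (j <= s)%N -> lam m ^+ j <= (1 + lam m) ^+ s.
Proof.
move=> js; apply: (@le_trans _ _ ((1 + lam m) ^+ j)).
  by apply: lerXn2r; rewrite ?nnegrE ?addr_ge0 ?lam_ge0// lerDr.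
by apply: ler_weXn2l => //; exact: lam1_ge1.
Qed.

(** The real part of the product of the coefficient of [u] and the conjugate of the
    coefficient of [v]. *)
Definition cross u v m : R := fc u m * fc v m + fs u m * fs v m.

Definition sob_term s u m : R := (1 + lam m) ^+ s * cross u u m.

Lemma cross_ge0 u m : 0 <= cross u u m.
Proof. by rewrite /cross -!expr2 addr_ge0 ?sqr_ge0. Qed.

Lemma sob_term_ge0 s u m : 0 <= sob_term s u m.
Proof. by rewrite mulr_ge0 ?cross_ge0// exprn_ge0// addr_ge0// lam_ge0. Qed.

Lemma sobolev_sqrE s u : sobolev_sqr s u = (\esum_(m in [set: freq n]) (sob_term s u m)%:E)%E.
Proof. by congr esum; apply/funext => m; rewrite /sob_term /cross !expr2. Qed.

Lemma sobolev_sqr_ge0 s u : (0 <= sobolev_sqr s u)%E.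
Proof. by rewrite sobolev_sqrE; apply: esum_ge0 => m _; rewrite lee_fin sob_term_ge0. Qed.

(** This and [sobolev_sqr_le] say that the Sobolev norm, a sum over an unordered
    index set, is the supremum of the sums over boxes. *)
Lemma box_le_sobolev s u N :
  ((\sum_(m <- box n N) sob_term s u m)%:E <= sobolev_sqr s u)%E.
Proof.
rewrite sobolev_sqrE; apply: ereal_sup_ubound; exists [set` box n N].
  by split => //; exact: finite_seq.
by rewrite /= -fsbig_seq ?box_uniq// -sumEFin.
Qed.

Lemma sobolev_sqr_le s u (C : \bar R) :
  (forall N, (\sum_(m <- box n N) sob_term s u m)%:E <= C)%E ->
  (sobolev_sqr s u <= C)%E.
Proof.
move=> H; rewrite sobolev_sqrE; apply: ge_ereal_sup => _ [X [fX _] <-].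
rewrite fsbig_finite//=; set r := finmap.enum_fset _.
have ur : uniq r by exact: finmap.fset_uniq.
have [N rN] : exists N, {subset r <= box n N}.
  elim: r {ur} => [|m r [N IH]]; first by exists 0%N.
  have [N' mN'] := mem_box_ex m; exists (maxn N N') => p; rewrite inE => /orP[/eqP ->|pr].
    by apply: mem_box_le mN'; exact: leq_maxr.
  by apply: mem_box_le (IH _ pr); exact: leq_maxl.
apply: le_trans (H N); rewrite sumEFin lee_fin.
have -> : \sum_(m <- r) sob_term s u m = \sum_(m <- box n N | m \in r) sob_term s u m.
  rewrite -[RHS]big_filter; apply: perm_big; apply: uniq_perm; rewrite ?filter_uniq ?box_uniq//.
  by move=> m; rewrite mem_filter; apply/idP/andP => [mr|[]//]; split => //; exact: rN.
by rewrite big_mkcond; apply: ler_sum => m _; case: ifP => // _; exact: sob_term_ge0.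
Qed.

Lemma sobolevP s u : sobolev s u <->
  L2 u /\ exists C, forall N, \sum_(m <- box n N) sob_term s u m <= C.
Proof.
split=> -[hu]; last first.
  move=> [C HC]; split => //; apply: le_lt_trans (ltry C).
  by apply: sobolev_sqr_le => N; rewrite lee_fin.
move=> fu; split => //; exists (fine (sobolev_sqr s u)) => N.
rewrite -lee_fin fineK ?box_le_sobolev// ge0_fin_numE//.
exact: sobolev_sqr_ge0.
Qed.

Lemma sobolev_L2 s u : sobolev s u -> L2 u.
Proof. by case. Qed.

Lemma sobolevS r s u : (r <= s)%N -> sobolev s u -> sobolev r u.
Proof.
move=> rs /sobolevP[hu [C HC]]; apply/sobolevP; split=> //; exists C => N.
apply: le_trans (HC N); apply: ler_sum => m _; apply: ler_wpM2r; first exact: cross_ge0.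
by apply: ler_weXn2l => //; exact: lam1_ge1.
Qed.

(** The coefficients of the formal derivative are square-summable, so that
    [series_exists] applies. *)
Lemma sobolev_has_partial i u : sobolev 1 u -> has_partial i u.
Proof.
move=> /sobolevP[hu [C HC]]; have [sc ss] := fourier_sym hu.
have [||w hw] := @series_exists R n (fun m => (m i)%:~R * fs u m)
    (fun m => - ((m i)%:~R * fc u m)) C.
- by split=> m; rewrite !ffunE ?sc ?ss intrN; ring.
- move=> N; apply: le_trans (HC N); apply: ler_sum => m _.
  rewrite /sob_term expr1 (_ : _ + _ = (m i)%:~R ^+ 2 * cross u u m); last by rewrite /cross; ring.
  apply: ler_wpM2r; first exact: cross_ge0.
  by rewrite (le_trans (sqr_le_lam i m))// lerDr.
- by exists w; apply/is_partialE.
Qed.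

Lemma partialP i u : has_partial i u ->
  is_series (fun m => (m i)%:~R * fs u m) (fun m => - ((m i)%:~R * fc u m)) (partial i u).
Proof. by move=> /xgetPex -/(_ (cst 0)) /is_partialE. Qed.

Lemma partial_fourier i u m : sobolev 1 u ->
  fc (partial i u) m = (m i)%:~R * fs u m /\ fs (partial i u) m = - ((m i)%:~R * fc u m).
Proof.
move=> su; have [sc ss] := fourier_sym (sobolev_L2 su).
apply: (series_fourier m _ (partialP (sobolev_has_partial i su))).
by split=> p; rewrite !ffunE ?sc ?ss intrN; ring.
Qed.

Lemma sobolev_partial s i u : sobolev s.+1 u -> sobolev s (partial i u).
Proof.
move=> su; have su1 : sobolev 1 u by exact: sobolevS su.
have [hw _] := partialP (sobolev_has_partial i su1).
apply/sobolevP; split => //; have /sobolevP[_ [C HC]] := su; exists C => N.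
apply: le_trans (HC N); apply: ler_sum => m _; have [wc ws] := partial_fourier i m su1.
rewrite /sob_term {1}/cross wc ws.
rewrite [X in _ * X <= _](_ : _ = (m i)%:~R ^+ 2 * cross u u m); last by rewrite /cross; ring.
rewrite mulrA; apply: ler_wpM2r; first exact: cross_ge0.
rewrite [leRHS]exprSr; apply: ler_wpM2l; first by rewrite exprn_ge0// addr_ge0// lam_ge0.
by rewrite (le_trans (sqr_le_lam i m))// lerDr.
Qed.

Lemma eq_series a b a' b' w : a =1 a' -> b =1 b' -> is_series a b w -> is_series a' b' w.
Proof. by move=> /funext -> /funext ->. Qed.

(** Each second derivative multiplies the coefficients by minus the square of one
    component of the frequency. *)
Lemma laplacian_series u : sobolev 2 u ->
  is_series (fun m => - lam m * fc u m) (fun m => - lam m * fs u m) (laplacian u).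
Proof.
move=> su; have su1 : sobolev 1 u by exact: sobolevS su.
apply: eq_series (is_series_sum (fun i => partialP (sobolev_has_partial i (sobolev_partial i su)))).
- move=> m; rewrite -sumrN mulr_suml; apply: eq_bigr => i _.
  by rewrite (partial_fourier i m su1).2; ring.
- move=> m; rewrite -sumrN mulr_suml; apply: eq_bigr => i _.
  by rewrite (partial_fourier i m su1).1; ring.
Qed.

Lemma lam_opp m : lam (- m) = lam m.
Proof. by apply: eq_bigr => i _; rewrite ffunE intrN sqrrN. Qed.

Lemma laplacian_fourier u m : sobolev 2 u ->
  fc (laplacian u) m = - lam m * fc u m /\ fs (laplacian u) m = - lam m * fs u m.
Proof.
move=> su; apply: (series_fourier m _ (laplacian_series su)).
have [sc ss] := fourier_sym (sobolev_L2 su).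
by split=> p; rewrite lam_opp ?sc ?ss// mulrN.
Qed.

Lemma sobolev_laplacian s u : sobolev s.+2 u -> sobolev s (laplacian u).
Proof.
move=> su; have su2 : sobolev 2 u by exact: sobolevS su.
have [hw _] := laplacian_series su2.
apply/sobolevP; split => //; have /sobolevP[_ [C HC]] := su; exists C => N.
apply: le_trans (HC N); apply: ler_sum => m _; have [wc ws] := laplacian_fourier m su2.
rewrite /sob_term {1}/cross wc ws.
rewrite [X in _ * X <= _](_ : _ = lam m ^+ 2 * cross u u m); last by rewrite /cross; ring.
rewrite mulrA; apply: ler_wpM2r; first exact: cross_ge0.
rewrite -(addn2 s) [leRHS]exprD; apply: ler_wpM2l; first by rewrite exprn_ge0// addr_ge0// lam_ge0.
exact: lamX_le.
Qed.

Lemma iter_laplacian j s u : sobolev (j.*2 + s) u ->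
  sobolev s (iter j (@laplacian R n) u) /\
  forall m, fc (iter j (@laplacian R n) u) m = (- lam m) ^+ j * fc u m /\
            fs (iter j (@laplacian R n) u) m = (- lam m) ^+ j * fs u m.
Proof.
elim: j s => [|j IH] s su; first by split => // m; rewrite !expr0 !mul1r.
have [|su' coef] := IH s.+2; first by rewrite !addnS; move: su; rewrite doubleS !addSn.
split; first exact: sobolev_laplacian.
move=> m; have [cc cs] := coef m.
have [|-> ->] := @laplacian_fourier (iter j (@laplacian R n) u) m; first exact: sobolevS su'.
by rewrite cc cs exprS; split; ring.
Qed.

Lemma iter_laplacian_series j u : (0 < j)%N -> sobolev j.*2 u ->
  is_series (fun m => (- lam m) ^+ j * fc u m) (fun m => (- lam m) ^+ j * fs u m)
    (iter j (@laplacian R n) u).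
Proof.
case: j => // j _ su; have [|su' coef] := @iter_laplacian j 2 u; first by rewrite addn2.
apply: eq_series (laplacian_series su') => m; have [cc cs] := coef m.
- by rewrite cc exprS; ring.
- by rewrite cs exprS; ring.
Qed.

Lemma has_nabla_sobolev k u : sobolev k u -> has_nabla k u.
Proof.
move=> su; split => [j i jk|ok i].
  have [|s2 _] := @iter_laplacian j 2 u; first by apply: sobolevS su; lia.
  split; first by apply: sobolev_has_partial; exact: sobolevS s2.
  by apply: sobolev_has_partial; exact: sobolev_partial s2.
have [|s1 _] := @iter_laplacian k./2 1 u; first by apply: sobolevS su; lia.
exact: sobolev_has_partial.
Qed.

Lemma L2_sum_integrable (I : Type) (s : seq I) (F G : I -> tpoint R n -> R) :
    (forall j, L2 (F j)) -> (forall j, L2 (G j)) ->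
  mu.-integrable setT (EFin \o (fun x => \sum_(j <- s) F j x * G j x)).
Proof.
move=> hF hG; rewrite (_ : _ \o _ = (fun x => \sum_(j <- s) (F j x * G j x)%:E)%E).
  by apply: integrable_sum => // j _; exact: L2_integrableM (hF j) (hG j).
by apply/funext => x; rewrite /= sumEFin.
Qed.

Lemma nabla_dot_integrable k u v : sobolev k u -> sobolev k v ->
  mu.-integrable setT (EFin \o nabla_dot k u v).
Proof.
move=> su sv; have E : (k./2.*2 + odd k)%N = k by lia.
have [|u1 _] := @iter_laplacian k./2 (odd k) u; first by rewrite E.
have [|v1 _] := @iter_laplacian k./2 (odd k) v; first by rewrite E.
rewrite /nabla_dot; case: (odd k) u1 v1 => u1 v1; last first.
  exact: L2_integrableM (sobolev_L2 u1) (sobolev_L2 v1).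
apply: L2_sum_integrable => i.
- exact: (partialP (sobolev_has_partial i u1)).1.
- exact: (partialP (sobolev_has_partial i v1)).1.
Qed.

(** The truncation to the box of size [N] of the integral of the product of the k-th
    derivatives, see [nabla_dot_cvg]. *)
Definition bform k N u v : R := vol * \sum_(m <- box n N) lam m ^+ k * cross u v m.

(** For k > 0 every factor in [nabla_dot k u v] is the sum of its Fourier series, so
    [series_ip] applies to it. For even k the signs (-1)^(k/2) of the two iterated
    Laplacians cancel; for odd k the sum over the components of the gradients gives
    the remaining factor lambda. *)
Lemma nabla_dot_cvg k u v : (0 < k)%N -> sobolev k u -> sobolev k v ->
  bform k N u v @[N --> \oo] --> \int[mu]_x nabla_dot k u v x.
Proof.
move=> k0 su sv; have E : (k./2.*2 + odd k)%N = k by lia.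
have [|u1 uco] := @iter_laplacian k./2 (odd k) u; first by rewrite E.
have [|v1 vco] := @iter_laplacian k./2 (odd k) v; first by rewrite E.
have sgn m : (- lam m) ^+ k./2 * (- lam m) ^+ k./2 * lam m ^+ odd k = lam m ^+ k.
  rewrite -[in RHS]E exprD -exprD addnn exprNn -signr_odd odd_double expr0 mul1r.
  by [].
rewrite /nabla_dot; case ok : (odd k) u1 v1 sgn => u1 v1 sgn.
  have pu i := partialP (sobolev_has_partial i u1).
  have pv i := partialP (sobolev_has_partial i v1).
  have -> : \int[mu]_x (\sum_(i < n) partial i (iter k./2 (@laplacian R n) u) x *
        partial i (iter k./2 (@laplacian R n) v) x) =
     \sum_(i < n) ip mu (partial i (iter k./2 (@laplacian R n) u))
                        (partial i (iter k./2 (@laplacian R n) v)).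
    elim: (index_enum _) => [|i s IH].
      under eq_Rintegral do rewrite big_nil.
      by rewrite Rintegral_cst// mul0r big_nil.
    rewrite big_cons -IH /ip -RintegralD//.
    - by apply: eq_Rintegral => x _; rewrite big_cons.
    - by apply: L2_integrableM; [exact: (pu i).1|exact: (pv i).1].
    - by apply: L2_sum_integrable => j; [exact: (pu j).1|exact: (pv j).1].
  rewrite (_ : (fun N => bform k N u v) = (fun N => \sum_(i < n) vol * \sum_(m <- box n N)
      (((m i)%:~R * fs (iter k./2 (@laplacian R n) u) m) *
       ((m i)%:~R * fs (iter k./2 (@laplacian R n) v) m) +
       - ((m i)%:~R * fc (iter k./2 (@laplacian R n) u) m) *
       - ((m i)%:~R * fc (iter k./2 (@laplacian R n) v) m)))); last first.
    apply/funext => N; rewrite -mulr_sumr exchange_big /=; congr (_ * _).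
    apply: eq_bigr => m _; have [-> ->] := uco m; have [-> ->] := vco m.
    rewrite -sgn expr1 /cross {3}/freq_sqr mulr_sumr mulr_suml.
    by apply: eq_bigr => i _; ring.
  apply: cvg_sumr => i _; apply: (series_ip _ (pu i) (pv i)).
  have [sc ss] := fourier_sym (sobolev_L2 u1).
  by split=> p; rewrite !ffunE ?sc ?ss intrN; ring.
have k2 : (0 < k./2)%N by lia.
have kE : k = k./2.*2 by lia.
have hu : sobolev k./2.*2 u by rewrite -kE.
have hv : sobolev k./2.*2 v by rewrite -kE.
have := series_ip _ (iter_laplacian_series k2 hu) (iter_laplacian_series k2 hv).
rewrite /ip => H; rewrite (_ : (fun N => bform k N u v) = (fun N => vol * \sum_(m <- box n N)
   ((- lam m) ^+ k./2 * fc u m * ((- lam m) ^+ k./2 * fc v m) +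
      (- lam m) ^+ k./2 * fs u m * ((- lam m) ^+ k./2 * fs v m)))).
  apply: H; have [sc ss] := fourier_sym (sobolev_L2 su).
  by split=> p; rewrite lam_opp ?sc ?ss// mulrN.
apply/funext => N; congr (_ * _); apply: eq_bigr => m _.
by rewrite -sgn expr0 /cross; ring.
Qed.

End sobolev_spaces.

(** * The functionals J_k in terms of Fourier coefficients *)
Section Jform.
Variable R : realType.
Implicit Types (A : R) (D B Q : nat -> R).

(** E_k, F_k and J_k as functions of the numbers A, D_j, B_j, Q_j, to be used with
    the exact values, with truncated ones and with ones that vary. *)
Definition Eform A D B k : R := B k / A + A * D k.
Definition Fform A D B k : R := B k / A - A * D k.
Definition Jform A D B Q k : R :=
  Eform A D B k - \sum_(2 <= j < k.+1) Q j * Q (k + 2 - j)%N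
  + 4^-1 * \sum_(2 <= j < k) (Eform A D B j * Eform A D B (k + 1 - j)
                              - Fform A D B j * Fform A D B (k + 1 - j)).

Lemma J_E n (p : state R n) k : J_ p k = Jform (A_ p) (D_ p) (B_ p) (Q_ p) k.
Proof. by []. Qed.

Lemma Jform_cvg (T : Type) (F : set_system T) (FF : Filter F)
    (A : T -> R) (D B Q : nat -> T -> R) A0 D0 B0 Q0 k : (2 <= k)%N -> A0 != 0 ->
    A x @[x --> F] --> A0 ->
    (forall j, (2 <= j <= k)%N -> [/\ D j x @[x --> F] --> D0 j,
       B j x @[x --> F] --> B0 j & Q j x @[x --> F] --> Q0 j]) ->
  Jform (A x) (D ^~ x) (B ^~ x) (Q ^~ x) k @[x --> F] --> Jform A0 D0 B0 Q0 k.
Proof.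
move=> k2 A0n cA cJ.
have cE j : (2 <= j <= k)%N -> Eform (A x) (D ^~ x) (B ^~ x) j @[x --> F] --> Eform A0 D0 B0 j.
  by move=> /cJ[cD cB cQ]; apply: cvgD; apply: cvgM => //; exact: cvgV.
have cF j : (2 <= j <= k)%N -> Fform (A x) (D ^~ x) (B ^~ x) j @[x --> F] --> Fform A0 D0 B0 j.
  by move=> /cJ[cD cB cQ]; apply: cvgB; apply: cvgM => //; exact: cvgV.
rewrite /Jform.
have H1 : \sum_(2 <= j < k.+1) Q j x * Q (k + 2 - j)%N x @[x --> F] -->
    \sum_(2 <= j < k.+1) Q0 j * Q0 (k + 2 - j)%N.
  under eq_fun do rewrite big_nat.
  rewrite big_nat; apply: cvg_sumr => j jk; apply: cvgM.
  - by have [|] := cJ j; first by lia.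
  - by have [|] := cJ (k + 2 - j)%N; first by lia.
have H2 : \sum_(2 <= j < k) (Eform (A x) (D ^~ x) (B ^~ x) j * Eform (A x) (D ^~ x) (B ^~ x) (k + 1 - j)
      - Fform (A x) (D ^~ x) (B ^~ x) j * Fform (A x) (D ^~ x) (B ^~ x) (k + 1 - j)) @[x --> F] -->
    \sum_(2 <= j < k) (Eform A0 D0 B0 j * Eform A0 D0 B0 (k + 1 - j)
                              - Fform A0 D0 B0 j * Fform A0 D0 B0 (k + 1 - j)).
  under eq_fun do rewrite big_nat.
  rewrite big_nat; apply: cvg_sumr => j jk.
  by apply: cvgB; apply: cvgM; [apply: cE|apply: cE|apply: cF|apply: cF]; lia.
apply: cvgD; first by apply: cvgB => //; apply: cE; rewrite k2 leqnn.
by apply: cvgM => //; exact: cvg_cst.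
Qed.

Lemma eq_Jform A D B Q D' B' Q' k : (2 <= k)%N -> (forall j, (2 <= j <= k)%N ->
    [/\ D j = D' j, B j = B' j & Q j = Q' j]) ->
  Jform A D B Q k = Jform A D' B' Q' k.
Proof.
move=> k2 H; have HE j : (2 <= j <= k)%N -> Eform A D B j = Eform A D' B' j.
  by move=> /H[h1 h2 _]; rewrite /Eform h1 h2.
have HF j : (2 <= j <= k)%N -> Fform A D B j = Fform A D' B' j.
  by move=> /H[h1 h2 _]; rewrite /Fform h1 h2.
rewrite /Jform HE ?k2 ?leqnn//; congr (_ - _ + _ * _); apply: eq_big_nat => j jk.
- by have [|_ _ ->] := H j; [lia|]; have [|_ _ ->] := H (k + 2 - j)%N; [lia|].
- by rewrite !HE ?HF//; lia.
Qed.

End Jform.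

Section functionals_by_Parseval.
Variables (R : realType) (n : nat).
Implicit Types (u v : tpoint R n -> R) (p : state R n).
Local Notation mu := (torus_measure R n).

Lemma D_cvg s p j : phase_space s p -> (1 <= j <= s)%N ->
  bform j N p.1 p.1 @[N --> \oo] --> D_ p j.
Proof. by move=> [su _] /andP[j1 js]; apply: nabla_dot_cvg => //; exact: sobolevS su. Qed.

Lemma B_cvg s p j : phase_space s p -> (2 <= j <= s)%N ->
  bform j.-1 N p.2 p.2 @[N --> \oo] --> B_ p j.
Proof.
by move=> [_ sv] js; apply: nabla_dot_cvg; [lia|apply: sobolevS sv; lia..].
Qed.

Lemma Q_cvg s p j : phase_space s p -> (2 <= j <= s)%N ->
  bform j.-1 N p.1 p.2 @[N --> \oo] --> Q_ p j.
Proof.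
by move=> [su sv] js; apply: nabla_dot_cvg; [lia|apply: sobolevS su; lia|apply: sobolevS sv; lia].
Qed.

Lemma D1_ge0 s p : phase_space s p -> 0 <= D_ p 1.
Proof.
by move=> ps; apply: Rintegral_ge0 => x _; apply: sumr_ge0 => i _; rewrite -expr2 sqr_ge0.
Qed.

(** All quantities in J_k are limits of expressions in the Fourier coefficients,
    which do not change on null sets. *)
Lemma J_well_definedP k : (2 <= k)%N -> J_well_defined R n k.
Proof.
move=> k2; split=> [u v [/= su sv] j jk|u v u' v' ps ps' uu vv].
  have su1 : sobolev j u by apply: sobolevS su; lia.
  have su2 : sobolev j.-1 u by apply: sobolevS su; lia.
  have sv1 : sobolev j.-1 v by apply: sobolevS sv; lia.
  by split; [exact: has_nabla_sobolev|exact: has_nabla_sobolev|exact: nabla_dot_integrable..].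
have [hu hv] := (sobolev_L2 ps.1, sobolev_L2 ps.2).
have [hu' hv'] := (sobolev_L2 ps'.1, sobolev_L2 ps'.2).
have Cuu : cross u u = cross u' u'.
  by apply/funext => m; rewrite /cross (fourier_cos_ae hu hu' uu) (fourier_sin_ae hu hu' uu).
have Cvv : cross v v = cross v' v'.
  by apply/funext => m; rewrite /cross (fourier_cos_ae hv hv' vv) (fourier_sin_ae hv hv' vv).
have Cuv : cross u v = cross u' v'.
  by apply/funext => m; rewrite /cross (fourier_cos_ae hu hu' uu) (fourier_sin_ae hu hu' uu)
     (fourier_cos_ae hv hv' vv) (fourier_sin_ae hv hv' vv).
have DE j : (1 <= j <= k)%N -> D_ (u, v) j = D_ (u', v') j.
  move=> jk; have c := D_cvg ps jk; have c' := D_cvg ps' jk.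
  by apply: (cvg_unique _ c) => //; rewrite /bform /= Cuu.
rewrite !J_E (_ : A_ (u, v) = A_ (u', v')); last by rewrite /A_ DE//; lia.
apply: eq_Jform => // j jk; split.
- by apply: DE; lia.
- have c := B_cvg ps jk; have c' := B_cvg ps' jk.
  by apply: (cvg_unique _ c) => //; rewrite /bform /= Cvv.
- have c := Q_cvg ps jk; have c' := Q_cvg ps' jk.
  by apply: (cvg_unique _ c) => //; rewrite /bform /= Cuv.
Qed.

End functionals_by_Parseval.

(** * Differentiation on an interval, with one-sided derivatives at its end points *)
Section interval_calculus.
Variable R : realType.
Implicit Types (f df F : R -> R) (I : set R).

Definition quot f t r : R := (f r - f t) / (r - t).

Lemma quot_is_derive f t l : quot f t r @[r --> t^'] --> l -> is_derive t 1 f l.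
Proof.
move=> H; have H' : h^-1 *: ((f \o shift t) (h *: 1) - f t) @[h --> 0^'] --> l.
  apply/cvgrPdist_le => e e0; have /cvgrPdist_le/(_ _ e0) := H.
  rewrite !near_withinE => /nbhs_ballP[d d0 Hd]; apply/nbhs_ballP; exists d => // h hd h0 /=.
  have E : h + t - t = h by rewrite addrK.
  have hb : ball t d (h + t).
    by move: hd; rewrite /ball /= sub0r normrN distrC E.
  have hn : h + t != t by rewrite -subr_eq0 E.
  have := Hd _ hb hn; rewrite /quot E /GRing.scale /= mulr1.
  by rewrite [_ / h]mulrC.
by apply: DeriveDef; [apply/cvg_ex; exists l|exact/cvg_lim].
Qed.

Lemma cvg_within_dnbhs I (t : R) (g : R -> R) : g r @[r --> within I t^'] --> g t ->
  g r @[r --> within I (nbhs t)] --> g t.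
Proof.
move=> /cvgrPdist_le H; apply/cvgrPdist_le => e e0; have := H e e0.
rewrite !near_withinE => /nbhs_ballP[d d0 Hd]; apply/nbhs_ballP; exists d => // r rd Ir.
have [->|rt] := eqVneq r t; first by rewrite subrr normr0 ltW.
exact: Hd.
Qed.

Lemma quot_continuous I f t (l : R) : quot f t r @[r --> within I t^'] --> l ->
  f r @[r --> within I (nbhs t)] --> f t.
Proof.
move=> H; apply: cvg_within_dnbhs.
have Ht : (fun r : R => r - t) @ within I t^' --> (0 : R).
  rewrite -(subrr t); apply: cvgB; last exact: cvg_cst.
  apply: cvg_trans (cvg_within _) _; exact: cvg_within.
have : (fun r : R => f t + quot f t r * (r - t)) @ within I t^' --> (f t + l * 0 : R).
  by apply: cvgD; [exact: cvg_cst|exact: cvgM].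
rewrite mulr0 addr0; apply: cvg_trans; apply: near_eq_cvg.
rewrite near_withinE; near=> r => _; rewrite /quot divfK ?subrKC//.
by rewrite subr_eq0; near: r; exact: nbhs_dnbhs_neq.
Unshelve. all: by end_near. Qed.

Lemma interval_interior I a b c : is_interval I -> I a -> I b -> a < c < b -> I° c.
Proof.
move=> iI Ia Ib /andP[ac cb]; rewrite /interior /=.
have : `]a, b[%classic `<=` I.
  by move=> x /=; rewrite in_itv /= => /andP[ax xb]; apply: (iI a b) => //; rewrite !ltW.
move/filterS; apply; apply: open_nbhs_nbhs; split; first exact: itv_open.
by rewrite /= in_itv /= ac cb.
Qed.

Lemma MVT_interval I f df a b : is_interval I ->
    (forall r, I r -> f x @[x --> within I (nbhs r)] --> f r) ->
    (forall r, I° r -> is_derive r 1 f (df r)) ->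
    I a -> I b -> a != b ->
  exists c, [/\ I c, `|c - a| <= `|b - a| & f b - f a = df c * (b - a)].
Proof.
move=> iI cf dF.
have key x y : I x -> I y -> x < y -> exists2 c, x < c < y & f y - f x = df c * (y - x).
  move=> Ix Iy xy.
  have [||c] := @MVT R f df x y xy.
  - by move=> z; rewrite in_itv /= => xzy; apply: dF; exact: interval_interior xzy.
  - apply/subspace_continuousP => z /=; rewrite in_itv /= => xzy.
    have Iz : I z by apply: (iI x y).
    apply: cvg_trans (cf z Iz); apply: cvg_app; apply: within_subset.
    by move=> w /=; rewrite in_itv /= => xwy; apply: (iI x y).
  - by rewrite in_itv /= => xcy E; exists c.
move=> Ia Ib; case: ltgtP => // ab _.
  have [c /andP[ac cb] E] := key a b Ia Ib ab; exists c; split => //.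
  - by apply: (iI a b) => //; rewrite !ltW.
  - by rewrite !ger0_norm ?subr_ge0; lra.
have [c /andP[bc ca] E] := key b a Ib Ia ab; exists c; split => //.
- by apply: (iI b a) => //; rewrite !ltW.
- by rewrite !ler0_norm ?subr_le0; lra.
- by rewrite -(opprB a b) mulrN -E opprB.
Qed.

(** By the mean value theorem a difference quotient of [f N] is a value of [df N] at
    an intermediate point, which is close to [l] once N is large and the point is
    close to [t]; this bound survives the limit in N. Joint convergence at the single
    point [t] is thus enough. *)
Lemma quot_limit I (f df : nat -> R -> R) F t (l : R) : is_interval I -> I t ->
    (forall N r, I r -> f N x @[x --> within I (nbhs r)] --> f N r) ->
    (forall N r, I° r -> is_derive r 1 (f N) (df N r)) ->
    (forall r, I r -> f N r @[N --> \oo] --> F r) ->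
    df p.1 p.2 @[p --> filter_prod \oo (within I (nbhs t))] --> l ->
  quot F t r @[r --> within I t^'] --> l.
Proof.
move=> iI It cf dF fF /cvgrPdist_le H; apply/cvgrPdist_le => e e0.
have [[/= P Q] [[N0 _ PN] /nbhs_ballP[d d0 Qd]] PQ] := H e e0.
rewrite near_withinE; apply/nbhs_ballP; exists d => // r rd rt Ir /=.
have bound N : (N0 <= N)%N -> `|l * (r - t) - (f N r - f N t)| <= e * `|r - t|.
  move=> N0N; have tr : t != r by rewrite eq_sym.
  have [c [Ic ct ->]] := MVT_interval iI (cf N) (dF N) It Ir tr.
  rewrite -mulrBl normrM ler_wpM2r//; apply: (PQ (N, c)); split; first exact: PN.
  apply: Qd => //=; rewrite /ball /= distrC; apply: le_lt_trans ct _.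
  by rewrite distrC.
have rt0 : 0 < `|r - t| by rewrite normr_gt0 subr_eq0.
rewrite -(ler_pM2r rt0) -normrM mulrBl divfK ?subr_eq0//.
have cv : `|l * (r - t) - (f N r - f N t)| @[N --> \oo] --> `|l * (r - t) - (F r - F t)|.
  apply: cvg_norm; apply: cvgB; first exact: cvg_cst.
  by apply: cvgB; exact: fF.
rewrite -(cvg_lim _ cv)//; apply: limr_le; first by apply/cvg_ex; eexists; exact: cv.
near=> N; apply: bound; near: N; exact: nbhs_infty_ge.
Unshelve. all: by end_near. Qed.

Lemma within_dnbhs_interior I (r : R) : I° r -> within I r^' = r^'.
Proof.
move=> Ir; rewrite predeqE => A; split=> h.
  exact: (filterS (fun x (p : I x /\ (x != r -> I x -> A x)) xr => p.2 xr p.1)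
            (filterI Ir h)).
exact: (filterS (fun x (hx : x != r -> A x) xr (_ : I x) => hx xr) h).
Qed.

Lemma quot0_constant I F : is_interval I ->
    (forall t, I t -> quot F t r @[r --> within I t^'] --> 0) ->
  forall a b, I a -> I b -> F a = F b.
Proof.
move=> iI H a b Ia Ib; have [->//|ab] := eqVneq a b.
have [||c [_ _ E]] := @MVT_interval I F (fun=> 0) a b iI _ _ Ia Ib ab.
- by move=> r Ir; exact: quot_continuous (H r Ir).
- move=> r Ir; apply: quot_is_derive; have := H r (interior_subset Ir).
  by rewrite within_dnbhs_interior.
- by move/eqP: E; rewrite mul0r subr_eq0 => /eqP.
Qed.

End interval_calculus.

(** * Continuity of the quadratic functionals, uniformly in the truncation *)
Section bilinear_estimates.
Variables (R : realType) (n : nat).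
Implicit Types (m : freq n) (u v w f g : tpoint R n -> R).
Local Notation mu := (torus_measure R n).
Local Notation vol := (vol R n).
Local Notation L2 f := (f \in Lfun mu 2%:E).
Local Notation lam := (@freq_sqr R n).
Local Notation fc := (@fourier_cos R n).
Local Notation fs := (@fourier_sin R n).

(** [bform] is the inner product of the trigonometric polynomials whose coefficients
    carry the weight lambda^(k/2). *)
Lemma bform_cauchy k N u v : L2 u -> L2 v ->
  `|bform k N u v| <= Num.sqrt (bform k N u u) * Num.sqrt (bform k N v v).
Proof.
move=> hu hv; pose c m := Num.sqrt (lam m ^+ k).
have cc m : c m * c m = lam m ^+ k by rewrite -expr2 sqr_sqrtr// exprn_ge0// lam_ge0.
pose T f := trig N (fun m => c m * fc f m) (fun m => c m * fs f m).
have E f g : L2 f -> bform k N f g = ip mu (T f) (T g).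
  move=> hf; have [sc ss] := fourier_sym hf.
  rewrite ip_trig; last by split=> m; rewrite /c lam_opp ?sc ?ss// mulrN.
  by congr (_ * _); apply: eq_bigr => m _; rewrite -cc /cross; ring.
by rewrite !E//; apply: ip_cauchy; exact: L2_trig.
Qed.

(** The H^s norm, scaled so that [bform_bound] holds without a constant. *)
Definition hnorm s u : R := Num.sqrt (vol * fine (sobolev_sqr s u)).

Lemma bform_le k s N u : (k <= s)%N -> sobolev s u ->
  Num.sqrt (bform k N u u) <= hnorm s u.
Proof.
move=> ks [_ fu]; have s0 := sobolev_sqr_ge0 s u.
rewrite ler_sqrt; last by rewrite mulr_ge0 ?(ltW (vol_gt0 _ _))// fine_ge0.
apply: ler_wpM2l; first exact: ltW (vol_gt0 _ _).
rewrite -lee_fin fineK; last by rewrite ge0_fin_numE.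
apply: le_trans (box_le_sobolev s u N); rewrite lee_fin; apply: ler_sum => m _.
by apply: ler_wpM2r; [exact: cross_ge0|exact: lamX_le].
Qed.

(** The bound does not depend on [N]. *)
Lemma bform_bound k s N u v : (k <= s)%N -> sobolev s u -> sobolev s v ->
  `|bform k N u v| <= hnorm s u * hnorm s v.
Proof.
move=> ks su sv; apply: le_trans (bform_cauchy _ _ (sobolev_L2 su) (sobolev_L2 sv)) _.
by apply: ler_pM; rewrite ?sqrtr_ge0//; exact: bform_le.
Qed.

Lemma bformC k N u v : bform k N u v = bform k N v u.
Proof. by congr (_ * _); apply: eq_bigr => m _; rewrite /cross; ring. Qed.

Lemma bformDl k N u v w : L2 u -> L2 v ->
  bform k N (fun x => u x + v x) w = bform k N u w + bform k N v w.
Proof.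
move=> hu hv; rewrite -mulrDr -big_split; congr (_ * _); apply: eq_bigr => m _ /=.
by rewrite /cross fourier_cosD// fourier_sinD//; ring.
Qed.

Lemma bformZl k N c u w : L2 u -> bform k N (fun x => c * u x) w = c * bform k N u w.
Proof.
move=> hu; rewrite /bform [RHS]mulrCA [X in _ = _ * X]mulr_sumr; congr (_ * _); apply: eq_bigr => m _.
by rewrite /cross fourier_cosZ// fourier_sinZ//; ring.
Qed.

Lemma bformBl k N u v w : L2 u -> L2 v ->
  bform k N (fun x => u x - v x) w = bform k N u w - bform k N v w.
Proof.
move=> hu hv; rewrite -mulrBr -sumrB; congr (_ * _); apply: eq_bigr => m _ /=.
by rewrite /cross fourier_cosB// fourier_sinB//; ring.
Qed.

Lemma sobolevZ s c u : sobolev s u -> sobolev s (fun x => c * u x).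
Proof.
move=> /sobolevP[hu [C HC]]; apply/sobolevP; split; first exact: L2Z.
exists (c ^+ 2 * C) => N; apply: le_trans (ler_wpM2l (sqr_ge0 c) (HC N)).
rewrite mulr_sumr; apply: ler_sum => m _.
rewrite /sob_term /cross fourier_cosZ// fourier_sinZ// le_eqVlt; apply/orP; left.
by apply/eqP; ring.
Qed.

Lemma sobolevD s u v : sobolev s u -> sobolev s v -> sobolev s (fun x => u x + v x).
Proof.
move=> /sobolevP[hu [C HC]] /sobolevP[hv [C' HC']]; apply/sobolevP; split; first exact: L2D.
exists (2 * C + 2 * C') => N.
apply: (@le_trans _ _ (2 * (\sum_(m <- box n N) sob_term s u m) +
    2 * (\sum_(m <- box n N) sob_term s v m))); last first.
  by apply: lerD; apply: ler_wpM2l.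
rewrite !mulr_sumr -big_split; apply: ler_sum => m _ /=.
rewrite /sob_term !(mulrCA 2) -mulrDr; apply: ler_wpM2l.
  by rewrite exprn_ge0// addr_ge0// lam_ge0.
rewrite /cross fourier_cosD// fourier_sinD//.
have := sqr_ge0 (fc u m - fc v m); have := sqr_ge0 (fs u m - fs v m); nra.
Qed.

Lemma sobolevB s u v : sobolev s u -> sobolev s v -> sobolev s (fun x => u x - v x).
Proof.
move=> su sv; have := sobolevD su (sobolevZ (-1) sv).
by rewrite (_ : (fun x => u x + -1 * v x) = (fun x => u x - v x))//;
   apply/funext => x; rewrite mulN1r.
Qed.

Lemma sobolev0 s : sobolev s (cst 0 : tpoint R n -> R).
Proof.
apply/sobolevP; split; first exact: Lfun_cst.
have E (f : tpoint R n -> R) : ip mu (cst 0) f = 0.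
  by rewrite /ip; under eq_Rintegral do rewrite mul0r; rewrite Rintegral_cst// mul0r.
exists 0 => N; rewrite big1// => m _.
by rewrite /sob_term /cross fourier_cosE fourier_sinE !E; ring.
Qed.

Lemma hnorm_subrr s u : L2 u -> hnorm s (fun x => u x - u x) = 0.
Proof.
move=> hu; rewrite /hnorm (_ : sobolev_sqr s _ = 0%E) ?mulr0 ?sqrtr0//.
rewrite sobolev_sqrE esum1// => m _.
by rewrite /sob_term /cross fourier_cosB// fourier_sinB// !subrr !mulr0 addr0 mulr0.
Qed.

Lemma hnorm_cvg0 (T : Type) (F : set_system T) (FF : Filter F) s (f : T -> tpoint R n -> R) :
  (sobolev_sqr s (f x) @[x --> F] --> 0)%E -> hnorm s (f x) @[x --> F] --> 0.
Proof.
move=> H; have H1 : fine (sobolev_sqr s (f x)) @[x --> F] --> (0 : R).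
  exact: (fine_cvg H).
have H2 : (fun x => vol * fine (sobolev_sqr s (f x))) @ F --> (0 : R).
  by rewrite -(mulr0 vol); apply: cvgM => //; exact: cvg_cst.
have /(_ 0) := @sqrt_continuous R; rewrite /continuous_at sqrtr0 => c.
exact: (cvg_comp _ _ H2 c).
Qed.

Section moving.
Variables (I : set R) (s k : nat) (f g : R -> tpoint R n -> R) (t : R).
Hypotheses (It : I t) (ks : (k <= s)%N).
Hypotheses (sf : forall r, I r -> sobolev s (f r)) (sg : forall r, I r -> sobolev s (g r)).
Hypotheses (cf : hnorm s (fun x => f r x - f t x) @[r --> within I (nbhs t)] --> 0).
Hypotheses (cg : hnorm s (fun x => g r x - g t x) @[r --> within I (nbhs t)] --> 0).

(** It bounds the change of [bform k N f g] between the times [t] and [r], for all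
    [N] at once; see [le_err]. *)
Let err r : R := hnorm s (fun x => f r x - f t x) * hnorm s (fun x => g r x - g t x)
   + hnorm s (fun x => f r x - f t x) * hnorm s (g t)
   + hnorm s (f t) * hnorm s (fun x => g r x - g t x).

Let err0 : err r @[r --> within I (nbhs t)] --> 0.
Proof.
have := cvgD (cvgD (cvgM cf cg) (cvgM cf (cvg_cst (hnorm s (g t)))))
  (cvgM (cvg_cst (hnorm s (f t))) cg).
by rewrite !mul0r mulr0 !addr0; apply.
Qed.

Let le_err N r : I r -> `|bform k N (f r) (g r) - bform k N (f t) (g t)| <= err r.
Proof.
move=> Ir; have [hfr hgr] := (sobolev_L2 (sf Ir), sobolev_L2 (sg Ir)).
have [hft hgt] := (sobolev_L2 (sf It), sobolev_L2 (sg It)).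
have hd := L2B hgr hgt.
have -> : bform k N (f r) (g r) - bform k N (f t) (g t) =
   bform k N (fun x => f r x - f t x) (fun x => g r x - g t x)
   + bform k N (fun x => f r x - f t x) (g t)
   + bform k N (f t) (fun x => g r x - g t x).
  rewrite !bformBl// ![bform k N _ (fun x => _ - _)]bformC !bformBl//.
  rewrite ![bform k N (g _) _]bformC; ring.
have sdf := sobolevB (sf Ir) (sf It); have sdg := sobolevB (sg Ir) (sg It).
apply: le_trans (ler_normD _ _) _; apply: lerD; last by apply: bform_bound => //; exact: sf.
apply: le_trans (ler_normD _ _) _; apply: lerD; apply: bform_bound => //; exact: sg.
Qed.

Lemma bform_within N : bform k N (f r) (g r) @[r --> within I (nbhs t)] -->
  bform k N (f t) (g t).
Proof.
apply/subr_cvg0/norm_cvg0P; apply: (squeeze_cvgr _ (cvg_cst 0) err0).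
by rewrite near_withinE; near=> r => Ir; rewrite normr_ge0 le_err.
Unshelve. all: by end_near. Qed.

(** Bounding the change in time by [err], uniformly in [N], leaves the limit in [N]
    at the fixed time [t]. *)
Lemma bform_joint : (0 < k)%N ->
  bform k p.1 (f p.2) (g p.2) @[p --> filter_prod \oo (within I (nbhs t))]
    --> \int[mu]_x nabla_dot k (f t) (g t) x.
Proof.
move=> k0.
have lim : (fun p : nat * R => bform k p.1 (f t) (g t)) @ filter_prod \oo (within I (nbhs t))
    --> \int[mu]_x nabla_dot k (f t) (g t) x.
  have H := nabla_dot_cvg k0 (sobolevS ks (sf It)) (sobolevS ks (sg It)).
  by move=> A /H HA; exists ([set N | A (bform k N (f t) (g t))], setT);
    [split => //=; exact: filterT|move=> [N r] /= []].
have diff : (fun p : nat * R => bform k p.1 (f p.2) (g p.2) - bform k p.1 (f t) (g t))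
    @ filter_prod \oo (within I (nbhs t)) --> (0 : R).
  have err2 : err p.2 @[p --> filter_prod (\oo : set_system nat) (within I (nbhs t))] --> 0.
    by move=> A /err0 HA; exists (setT, [set r | A (err r)]);
      [split => //=; exact: filterT|move=> [N r] /= []].
  apply/norm_cvg0P; apply: (squeeze_cvgr _ (cvg_cst 0) err2).
  exists (setT, I); first by split; [exact: filterT|exact: withinT].
  by move=> [N r] /= [_ Ir]; rewrite normr_ge0 le_err.
rewrite (_ : (fun p : nat * R => _) = (fun p : nat * R =>
    (bform k p.1 (f p.2) (g p.2) - bform k p.1 (f t) (g t)) + bform k p.1 (f t) (g t))).
  by have := cvgD diff lim; rewrite add0r; apply.
by apply/funext => p; rewrite subrK.
Qed.

Lemma nabla_dot_within : (0 < k)%N ->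
  \int[mu]_x nabla_dot k (f r) (g r) x @[r --> within I (nbhs t)]
    --> \int[mu]_x nabla_dot k (f t) (g t) x.
Proof.
move=> k0; have lim r : I r -> bform k N (f r) (g r) @[N --> \oo]
    --> \int[mu]_x nabla_dot k (f r) (g r) x.
  by move=> Ir; exact: nabla_dot_cvg k0 (sobolevS ks (sf Ir)) (sobolevS ks (sg Ir)).
apply/subr_cvg0/norm_cvg0P; apply: (squeeze_cvgr _ (cvg_cst 0) err0).
rewrite near_withinE; near=> r => Ir; rewrite normr_ge0/=.
have c : `|bform k N (f r) (g r) - bform k N (f t) (g t)| @[N --> \oo] -->
    `|\int[mu]_x nabla_dot k (f r) (g r) x - \int[mu]_x nabla_dot k (f t) (g t) x|.
  exact: cvg_norm (cvgB (lim r Ir) (lim t It)).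
rewrite -(cvg_lim _ c)//; apply: limr_le; first by apply/cvg_ex; eexists; exact: c.
by apply: nearW => N; exact: le_err.
Unshelve. all: by end_near. Qed.

End moving.

End bilinear_estimates.

(** * The conservation law for the truncated functionals *)
Section derivative_rules.
Variable R : realType.
Implicit Types (f g : R -> R) (t a b : R).

Lemma derD f g t a b : is_derive t 1 f a -> is_derive t 1 g b ->
  is_derive t 1 (fun r => f r + g r) (a + b).
Proof. by move=> df dg; exact: is_deriveD. Qed.

Lemma derB f g t a b : is_derive t 1 f a -> is_derive t 1 g b ->
  is_derive t 1 (fun r => f r - g r) (a - b).
Proof. by move=> df dg; exact: is_deriveB. Qed.

Lemma derM f g t a b : is_derive t 1 f a -> is_derive t 1 g b ->
  is_derive t 1 (fun r => f r * g r) (a * g t + f t * b).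
Proof.
move=> df dg; apply: (is_derive_eq (is_deriveM df dg)).
by rewrite /GRing.scale /=; ring.
Qed.

Lemma derV f t a : f t != 0 -> is_derive t 1 f a ->
  is_derive t 1 (fun r => (f r)^-1) (- a / f t ^+ 2).
Proof.
move=> f0 df; apply: (is_derive_eq (is_deriveV f0 df)).
by rewrite /GRing.scale /=; field.
Qed.

Lemma derZ c f t a : is_derive t 1 f a -> is_derive t 1 (fun r => c * f r) (c * a).
Proof. by move=> df; exact: is_deriveZ. Qed.

Lemma der_sum (I : Type) (s : seq I) (P : pred I) (f : I -> R -> R) (a : I -> R) t :
  (forall i, P i -> is_derive t 1 (f i) (a i)) ->
  is_derive t 1 (fun r => \sum_(i <- s | P i) f i r) (\sum_(i <- s | P i) a i).
Proof.
move=> H; elim: s => [|i s IH].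
  under eq_fun do rewrite big_nil; rewrite big_nil; exact: is_derive_cst.
under eq_fun do rewrite big_cons; rewrite big_cons; case: ifP => // Pi.
exact: derD (H i Pi) IH.
Qed.

Lemma der_sum_nat m n (f : nat -> R -> R) (a : nat -> R) t :
  (forall i, (m <= i < n)%N -> is_derive t 1 (f i) (a i)) ->
  is_derive t 1 (fun r => \sum_(m <= i < n) f i r) (\sum_(m <= i < n) a i).
Proof.
by move=> H; under eq_fun do rewrite big_nat; rewrite big_nat; exact: der_sum.
Qed.

End derivative_rules.

Section conservation.
Variables (R : realType) (A : R -> R) (D B Q : nat -> R -> R) (t q : R).
Hypotheses (A0 : A t != 0) (dA : is_derive t 1 A (- 2 * A t ^+ 2 * q)).
Hypothesis dD : forall j, (1 <= j)%N -> is_derive t 1 (D j) (2 * Q j.+1 t).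
Hypothesis dB : forall j, (1 <= j)%N -> is_derive t 1 (B j) (- 2 * A t ^+ 2 * Q j.+1 t).
Hypothesis dQ : forall j, (1 <= j)%N -> is_derive t 1 (Q j) (B j t - A t ^+ 2 * D j t).

Let e j r : R := Eform (A r) (D ^~ r) (B ^~ r) j.
Let f j r : R := Fform (A r) (D ^~ r) (B ^~ r) j.

Let dE j : (1 <= j)%N -> is_derive t 1 (e j) (2 * A t * q * f j t).
Proof.
move=> j1; apply: (is_derive_eq
  (derD (derM (dB j1) (derV A0 dA)) (derM dA (dD j1)))).
by rewrite /f /Fform; field.
Qed.

Let dF j : (1 <= j)%N -> is_derive t 1 (f j) (2 * A t * q * e j t - 4 * A t * Q j.+1 t).
Proof.
move=> j1; apply: (is_derive_eq
  (derB (derM (dB j1) (derV A0 dA)) (derM dA (dD j1)))).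
by rewrite /e /Eform; field.
Qed.

Let dQ' j : (1 <= j)%N -> is_derive t 1 (Q j) (A t * f j t).
Proof.
by move=> j1; apply: (is_derive_eq (dQ j1)); rewrite /f /Fform; field.
Qed.

(** In the derivative of the last sum of J_k the terms with [q] cancel pairwise, and
    the others are the terms of the derivative of the first sum, except for two equal
    boundary terms. The derivative vanishes when [q] is [Q 2]; for truncated
    quantities [q] is the exact Q_2, which governs A. *)
Lemma Jform_derive k : (2 <= k)%N ->
  is_derive t 1 (fun r => Jform (A r) (D ^~ r) (B ^~ r) (Q ^~ r) k)
    (2 * A t * f k t * (q - Q 2 t)).
Proof.
move=> k2.
have d1 : is_derive t 1 (fun r => \sum_(2 <= j < k.+1) Q j r * Q (k + 2 - j)%N r)
    (\sum_(2 <= j < k.+1) (A t * f j t * Q (k + 2 - j)%N t +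
                           Q j t * (A t * f (k + 2 - j)%N t))).
  apply: der_sum_nat => j jk.
  by apply: derM; apply: dQ'; lia.
have d2 : is_derive t 1 (fun r => \sum_(2 <= j < k) (e j r * e (k + 1 - j)%N r
                              - f j r * f (k + 1 - j)%N r))
    (\sum_(2 <= j < k) 4 * A t * (Q j.+1 t * f (k + 1 - j)%N t + f j t * Q (k + 2 - j)%N t)).
  apply: der_sum_nat => j jk.
  have j1 : (1 <= j)%N by lia.
  have kj1 : (1 <= k + 1 - j)%N by lia.
  apply: (is_derive_eq (derB (derM (dE j1) (dE kj1)) (derM (dF j1) (dF kj1)))).
  rewrite (_ : (k + 1 - j).+1 = k + 2 - j)%N; last by lia.
  ring.
have k1 : (1 <= k)%N by lia.
apply: (is_derive_eq (derD (derB (dE k1) d1) (derZ 4^-1 d2))).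
set S1 := \sum_(2 <= j < k) f j t * Q (k + 2 - j)%N t.
set S2 := \sum_(2 <= j < k) Q j.+1 t * f (k + 1 - j)%N t.
have -> : \sum_(2 <= j < k.+1) (A t * f j t * Q (k + 2 - j)%N t +
      Q j t * (A t * f (k + 2 - j)%N t)) =
    A t * (S1 + f k t * Q 2 t) + A t * (Q 2 t * f k t + S2).
  rewrite big_split /=; congr (_ + _).
    rewrite big_nat_recr//= (_ : k + 2 - k = 2)%N; last by lia.
    rewrite [RHS]mulrDr mulrA; congr (_ + _).
    by rewrite /S1 [RHS]mulr_sumr; apply: eq_bigr => j _; rewrite mulrA.
  rewrite big_nat_recl//= (_ : k + 2 - 2 = k)%N; last by lia.
  rewrite [RHS]mulrDr; congr (_ + _); first by ring.
  rewrite /S2 [RHS]mulr_sumr !big_nat; apply: eq_bigr => j jk.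
  by rewrite (_ : k + 2 - j.+1 = k + 1 - j)%N; [ring|lia].
have -> : \sum_(2 <= j < k) 4 * A t * (Q j.+1 t * f (k + 1 - j)%N t + f j t * Q (k + 2 - j)%N t)
    = 4 * A t * (S2 + S1).
  by rewrite -mulr_sumr big_split.
by field.
Qed.

End conservation.

(** * Solutions *)
Section Fourier_modes_of_limits.
Variables (R : realType) (n : nat).
Implicit Types (m : freq n) (u v w : tpoint R n -> R).
Local Notation fc := (@fourier_cos R n).
Local Notation fs := (@fourier_sin R n).

Lemma cross_le_sobolev s u m : ((cross u u m)%:E <= sobolev_sqr s u)%E.
Proof.
have [N mN] := mem_box_ex m; apply: le_trans (box_le_sobolev s u N); rewrite lee_fin.
apply: (@le_trans _ _ (sob_term s u m)).
  by rewrite ler_peMl ?cross_ge0// exprn_ege1// lam1_ge1.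
rewrite (bigD1_seq m)//= ?box_uniq// lerDl.
by apply: sumr_ge0 => p _; exact: sob_term_ge0.
Qed.

Lemma sobolev_sqr_mono r s u : (r <= s)%N -> (sobolev_sqr r u <= sobolev_sqr s u)%E.
Proof.
move=> rs; apply: sobolev_sqr_le => N; apply: le_trans (box_le_sobolev s u N).
rewrite lee_fin; apply: ler_sum => m _; apply: ler_wpM2r; first exact: cross_ge0.
by apply: ler_weXn2l => //; exact: lam1_ge1.
Qed.

Lemma hnorm_mono r s u : (r <= s)%N -> sobolev s u -> hnorm r u <= hnorm s u.
Proof.
move=> rs su; have sr := sobolevS rs su.
have fin q : sobolev q u -> sobolev_sqr q u \is a fin_num.
  by case=> _; rewrite -ge0_fin_numE// sobolev_sqr_ge0.
have v0 := ltW (vol_gt0 R n).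
rewrite ler_sqrt; last by rewrite mulr_ge0// fine_ge0// sobolev_sqr_ge0.
by rewrite ler_wpM2l// fine_le ?fin// sobolev_sqr_mono.
Qed.

(** The coefficient at one frequency is bounded by any Sobolev norm. *)
Lemma fourier_cvg0 (T : Type) (F : set_system T) (FF : Filter F) s
    (w : T -> tpoint R n -> R) m :
  (sobolev_sqr s (w x) @[x --> F] --> 0)%E ->
  fc (w x) m @[x --> F] --> 0 /\ fs (w x) m @[x --> F] --> 0.
Proof.
move=> H.
have C0 : cross (w x) (w x) m @[x --> F] --> 0.
  have : ((cross (w x) (w x) m)%:E @[x --> F] --> 0)%E.
    apply: (squeeze_cvge _ (cvg_cst 0%E) H).
    by apply: nearW => x; rewrite lee_fin cross_ge0 cross_le_sobolev.
  by move/fine_cvg.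
have sq (a : T -> R) : (forall x, a x ^+ 2 <= cross (w x) (w x) m) -> a x @[x --> F] --> 0.
  move=> le; apply/norm_cvg0P.
  have S0 : Num.sqrt (cross (w x) (w x) m) @[x --> F] --> 0.
    have /(_ 0) := @sqrt_continuous R; rewrite /continuous_at sqrtr0 => c.
    exact: (cvg_comp _ _ C0 c).
  apply: (squeeze_cvgr _ (cvg_cst 0) S0); apply: nearW => x.
  by rewrite normr_ge0/= -sqrtr_sqr ler_sqrt ?le// cross_ge0.
by split; apply: sq => x; rewrite /cross -!expr2; rewrite ?lerDl ?lerDr sqr_ge0.
Qed.

End Fourier_modes_of_limits.

Lemma bform_derive (R : realType) (n j N : nat) (f g : R -> tpoint R n -> R) (t : R)
    (a b a' b' : freq n -> R) :
    (forall m, is_derive t 1 (fun r => fourier_cos (f r) m) (a m)) ->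
    (forall m, is_derive t 1 (fun r => fourier_sin (f r) m) (b m)) ->
    (forall m, is_derive t 1 (fun r => fourier_cos (g r) m) (a' m)) ->
    (forall m, is_derive t 1 (fun r => fourier_sin (g r) m) (b' m)) ->
  is_derive t 1 (fun r => bform j N (f r) (g r))
    (vol R n * \sum_(m <- box n N) freq_sqr R m ^+ j *
       (a m * fourier_cos (g t) m + fourier_cos (f t) m * a' m
        + (b m * fourier_sin (g t) m + fourier_sin (f t) m * b' m))).
Proof.
move=> da db da' db'; apply: derZ; apply: der_sum => m _; apply: derZ.
by apply: derD; apply: derM.
Qed.

Section solutions.
Variables (R : realType) (n k : nat) (I : set R) (u v : R -> tpoint R n -> R).
Hypotheses (k2 : (2 <= k)%N) (iI : is_interval I).
Hypothesis sol : kirchhoff_pohozaev_solution k I u v.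
Implicit Types (m : freq n) (r t : R).
Local Notation mu := (torus_measure R n).
Local Notation lam := (@freq_sqr R n).
Local Notation fc := (@fourier_cos R n).
Local Notation fs := (@fourier_sin R n).
Local Notation p r := ((u r, v r) : state R n).
Local Notation A r := (A_ (p r)).

Let ps t : I t -> phase_space k (p t).
Proof. by move=> /sol[]. Qed.

Let su t : I t -> sobolev k (u t).
Proof. by move=> /ps[]. Qed.

Let sv t : I t -> sobolev k.-1 (v t).
Proof. by move=> /ps[]. Qed.

Let su1 t : I t -> sobolev k.-1 (u t).
Proof. by move=> /su; apply: sobolevS; exact: leq_pred. Qed.

Let cu t : I t -> hnorm k (fun x => u r x - u t x) @[r --> within I (nbhs t)] --> 0.
Proof.
move=> It; have [_ H _ _] := sol It.
rewrite -(hnorm_subrr k (sobolev_L2 (su It))).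
apply: cvg_within_dnbhs; rewrite hnorm_subrr ?(sobolev_L2 (su It))//; apply: hnorm_cvg0.
apply: (squeeze_cvge _ (cvg_cst 0%E) H); apply: nearW => r.
by rewrite sobolev_sqr_ge0/= leeDl// sobolev_sqr_ge0.
Qed.

Let cv t : I t -> hnorm k.-1 (fun x => v r x - v t x) @[r --> within I (nbhs t)] --> 0.
Proof.
move=> It; have [_ H _ _] := sol It.
rewrite -(hnorm_subrr k.-1 (sobolev_L2 (sv It))).
apply: cvg_within_dnbhs; rewrite hnorm_subrr ?(sobolev_L2 (sv It))//; apply: hnorm_cvg0.
apply: (squeeze_cvge _ (cvg_cst 0%E) H); apply: nearW => r.
by rewrite sobolev_sqr_ge0/= leeDr// sobolev_sqr_ge0.
Qed.

Let cu1 t : I t -> hnorm k.-1 (fun x => u r x - u t x) @[r --> within I (nbhs t)] --> 0.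
Proof.
move=> It; apply: (squeeze_cvgr _ (cvg_cst 0) (cu It)).
rewrite near_withinE; near=> r => Ir; rewrite sqrtr_ge0/=.
by apply: hnorm_mono; [exact: leq_pred|exact: sobolevB (su Ir) (su It)].
Unshelve. all: by end_near. Qed.

(** The equation u_t = v, read off at one frequency; [mode_v] does the same for
    v_t = A^2 Delta u. Convergence of the difference quotients in a weak Sobolev norm
    suffices for this. *)
Let mode_u t m : I t ->
  quot (fun r => fc (u r) m) t r @[r --> within I t^'] --> fc (v t) m /\
  quot (fun r => fs (u r) m) t r @[r --> within I t^'] --> fs (v t) m.
Proof.
move=> It; have [_ _ /(@fourier_cvg0 _ _ _ _ _ _ _ m)[Hc Hs] _] := sol It.
have [hut hvt] := (sobolev_L2 (su It), sobolev_L2 (sv It)).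
split; apply/subr_cvg0; [apply: cvg_trans Hc|apply: cvg_trans Hs]; apply: near_eq_cvg;
  rewrite near_withinE; near=> r => Ir; have hur := sobolev_L2 (su Ir);
  have hd := L2B hur hut; have hZ := L2Z (r - t)^-1 hd;
  under [X in _ X m = _]eq_fun do rewrite mulrC.
- by rewrite fourier_cosB// fourier_cosZ// fourier_cosB// /quot mulrC.
- by rewrite fourier_sinB// fourier_sinZ// fourier_sinB// /quot mulrC.
Unshelve. all: by end_near. Qed.

Let A2E t : (1 + \int[mu]_y nabla_dot 1 (u t) (u t) y) ^- 2 = A t ^+ 2.
Proof. by rewrite /A_ exprVn. Qed.

Let mode_v t m : I t ->
  quot (fun r => fc (v r) m) t r @[r --> within I t^'] --> - (A t ^+ 2 * lam m * fc (u t) m) /\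
  quot (fun r => fs (v r) m) t r @[r --> within I t^'] --> - (A t ^+ 2 * lam m * fs (u t) m).
Proof.
move=> It; have [_ _ _ /(@fourier_cvg0 _ _ _ _ _ _ _ m)[Hc Hs]] := sol It.
have su2 : sobolev 2 (u t) by apply: sobolevS (su It).
have [lc ls] := laplacian_fourier m su2.
have hL : laplacian (u t) \in Lfun mu 2%:E.
  by apply: (@sobolev_L2 _ _ 0); exact: sobolev_laplacian.
have hvt := sobolev_L2 (sv It).
have hAL := L2Z (A t ^+ 2) hL.
split; apply/subr_cvg0; [apply: cvg_trans Hc|apply: cvg_trans Hs]; apply: near_eq_cvg;
  rewrite near_withinE; near=> r => Ir; have hvr := sobolev_L2 (sv Ir);
  have hd := L2B hvr hvt; have hZ := L2Z (r - t)^-1 hd;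
  under [X in _ X m = _]eq_fun do rewrite mulrC A2E.
- by rewrite fourier_cosB// !fourier_cosZ// fourier_cosB// lc /quot; ring.
- by rewrite fourier_sinB// !fourier_sinZ// fourier_sinB// ls /quot; ring.
Unshelve. all: by end_near. Qed.

Let is_der (f : R -> R) t l : I° t ->
  quot f t r @[r --> within I t^'] --> l -> is_derive t 1 f l.
Proof. by move=> It; rewrite within_dnbhs_interior//; exact: quot_is_derive. Qed.

Let duu j N t : I° t ->
  is_derive t 1 (fun r => bform j N (u r) (u r)) (2 * bform j N (u t) (v t)).
Proof.
move=> It; have It' := interior_subset It.
apply: (is_derive_eq (bform_derive j N
    (fun m => is_der It (mode_u m It').1) (fun m => is_der It (mode_u m It').2)
    (fun m => is_der It (mode_u m It').1) (fun m => is_der It (mode_u m It').2))).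
rewrite /bform [RHS]mulrCA; congr (_ * _); rewrite [RHS]mulr_sumr; apply: eq_bigr => m _.
by rewrite /cross; ring.
Qed.

Let dvv j N t : I° t ->
  is_derive t 1 (fun r => bform j N (v r) (v r)) (- 2 * A t ^+ 2 * bform j.+1 N (u t) (v t)).
Proof.
move=> It; have It' := interior_subset It.
apply: (is_derive_eq (bform_derive j N
    (fun m => is_der It (mode_v m It').1) (fun m => is_der It (mode_v m It').2)
    (fun m => is_der It (mode_v m It').1) (fun m => is_der It (mode_v m It').2))).
rewrite /bform [RHS]mulrCA; congr (_ * _); rewrite [RHS]mulr_sumr; apply: eq_bigr => m _.
by rewrite /cross [lam m ^+ j.+1]exprS; ring.
Qed.

Let duv j N t : I° t ->
  is_derive t 1 (fun r => bform j N (u r) (v r))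
    (bform j N (v t) (v t) - A t ^+ 2 * bform j.+1 N (u t) (u t)).
Proof.
move=> It; have It' := interior_subset It.
apply: (is_derive_eq (bform_derive j N
    (fun m => is_der It (mode_u m It').1) (fun m => is_der It (mode_u m It').2)
    (fun m => is_der It (mode_v m It').1) (fun m => is_der It (mode_v m It').2))).
rewrite /bform [X in _ = _ - X]mulrCA -[RHS]mulrBr; congr (_ * _).
rewrite [X in _ = _ - X]mulr_sumr -[RHS]sumrB; apply: eq_bigr => m _.
by rewrite /cross [lam m ^+ j.+1]exprS; ring.
Qed.

Let dD1 t : I t -> quot (fun r => D_ (p r) 1) t r @[r --> within I t^'] --> 2 * Q_ (p t) 2.
Proof.
move=> It; have k1 : (1 <= k.-1)%N by lia.
apply: (@quot_limit _ _ (fun N r => bform 1 N (u r) (u r)) (fun N r => 2 * bform 1 N (u r) (v r))) => //.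
- move=> N r Ir; apply: (@bform_within _ _ I k.-1 1 u u r Ir) => //; exact: cu1.
- by move=> N r Ir; exact: duu.
- by move=> r Ir; apply: (D_cvg (ps Ir)); lia.
- apply: cvgM; first exact: cvg_cst.
  by apply: (@bform_joint _ _ I k.-1 1 u v t It) => //; [exact: cu1|exact: cv].
Qed.

Let A_neq0 t : I t -> A t != 0.
Proof.
move=> It; rewrite invr_eq0 gt_eqF// ltr_pwDl//; exact: D1_ge0 (ps It).
Qed.

Let cA t : I t -> A r @[r --> within I (nbhs t)] --> A t.
Proof.
move=> It; apply: cvgV; first by rewrite -invr_eq0; exact: A_neq0.
by apply: cvgD; [exact: cvg_cst|exact: quot_continuous (dD1 It)].
Qed.

Let dA t : I° t -> is_derive t 1 (fun r => A r) (- 2 * A t ^+ 2 * Q_ (p t) 2).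
Proof.
move=> It; have It' := interior_subset It.
have D1n : 1 + D_ (p t) 1 != 0 by rewrite -invr_eq0; exact: A_neq0.
have d1 := derD (is_derive_cst (1 : R) t 1) (is_der It (dD1 It')).
apply: (@is_derive_eq _ _ _ _ _ _ _ _ (derV (f := fun r => 1 + D_ (p r) 1) D1n d1)).
by rewrite /A_; field.
Qed.

(** [quot_limit] applied to the truncated functionals, in which A is exact: their
    derivatives tend jointly to 2 A F_k (Q_2 - Q_2) = 0. *)
Lemma quot_J t : I t -> quot (fun r => J_ (p r) k) t r @[r --> within I t^'] --> 0.
Proof.
move=> It.
pose D N j r := bform j N (u r) (u r).
pose B N j r := bform j.-1 N (v r) (v r).
pose Q N j r := bform j.-1 N (u r) (v r).
have jointD j : (1 <= j <= k)%N -> D p.1 j p.2 @[p --> filter_prod \oo (within I (nbhs t))]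
    --> D_ (p t) j.
  by move=> jk; apply: (@bform_joint _ _ I k j u u t It) => //; try exact: cu; lia.
have jointB j : (2 <= j <= k)%N -> B p.1 j p.2 @[p --> filter_prod \oo (within I (nbhs t))]
    --> B_ (p t) j.
  by move=> jk; apply: (@bform_joint _ _ I k.-1 j.-1 v v t It) => //; try exact: cv; lia.
have jointQ j : (2 <= j <= k)%N -> Q p.1 j p.2 @[p --> filter_prod \oo (within I (nbhs t))]
    --> Q_ (p t) j.
  by move=> jk; apply: (@bform_joint _ _ I k.-1 j.-1 u v t It);
    [lia|exact: su1|exact: sv|exact: cu1|exact: cv|lia].
have contD N j r : I r -> (1 <= j <= k)%N -> D N j x @[x --> within I (nbhs r)] --> D N j r.
  by move=> Ir jk; apply: (@bform_within _ _ I k j u u r Ir) => //; try exact: cu; lia.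
have contB N j r : I r -> (2 <= j <= k)%N -> B N j x @[x --> within I (nbhs r)] --> B N j r.
  by move=> Ir jk; apply: (@bform_within _ _ I k.-1 j.-1 v v r Ir) => //; try exact: cv; lia.
have contQ N j r : I r -> (2 <= j <= k)%N -> Q N j x @[x --> within I (nbhs r)] --> Q N j r.
  by move=> Ir jk; apply: (@bform_within _ _ I k.-1 j.-1 u v r Ir);
    [lia|exact: su1|exact: sv|exact: cu1|exact: cv].
have A2 : A p.2 @[p --> filter_prod (\oo : set_system nat) (within I (nbhs t))] --> A t.
  by move=> S /(cA It) HS; exists (setT, [set r | S (A r)]);
    [split => //=; exact: filterT|move=> [N r] /= []].
have Q2 : Q_ (p p0.2) 2 @[p0 --> filter_prod (\oo : set_system nat) (within I (nbhs t))] --> Q_ (p t) 2.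
  have cQ : Q_ (p r) 2 @[r --> within I (nbhs t)] --> Q_ (p t) 2.
    by apply: (@nabla_dot_within _ _ I k.-1 1 u v t It);
      [lia|exact: su1|exact: sv|exact: cu1|exact: cv|].
  by move=> S /cQ HS; exists (setT, [set r | S (Q_ (p r) 2)]);
    [split => //=; exact: filterT|move=> [N r] /= []].
apply: (@quot_limit _ _ (fun N r => Jform (A r) (D N ^~ r) (B N ^~ r) (Q N ^~ r) k)
   (fun N r => 2 * A r * Fform (A r) (D N ^~ r) (B N ^~ r) k * (Q_ (p r) 2 - Q N 2 r))) => //.
- move=> N r Ir; apply: (@Jform_cvg R R (within I (nbhs r)) _ (fun r => A r) (D N) (B N) (Q N)
    (A r) (D N ^~ r) (B N ^~ r) (Q N ^~ r) k k2 (A_neq0 Ir) (cA Ir)).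
  by move=> j jk; split; [apply: (contD N j r Ir); lia|exact: contB|exact: contQ].
- move=> N r Ir; have Ir' := interior_subset Ir.
  apply: (@Jform_derive R (fun r => A r) (D N) (B N) (Q N) r (Q_ (p r) 2)
    (A_neq0 Ir') (dA Ir) _ _ _ k k2) => j j1.
  + exact: duu.
  + by have := dvv j.-1 N Ir; rewrite prednK.
  + by have := duv j.-1 N Ir; rewrite prednK.
- move=> r Ir; rewrite J_E; apply: (@Jform_cvg R nat \oo _ (fun=> A r) (fun j N => D N j r)
    (fun j N => B N j r) (fun j N => Q N j r)
    (A r) (D_ (p r)) (B_ (p r)) (Q_ (p r)) k k2 (A_neq0 Ir) (cvg_cst _)).
  move=> j jk; split; [apply: (D_cvg (ps Ir)); lia|exact: (B_cvg (ps Ir))|exact: (Q_cvg (ps Ir))].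
- have cF : Fform (A p.2) (D p.1 ^~ p.2) (B p.1 ^~ p.2) k
      @[p --> filter_prod \oo (within I (nbhs t))] --> Fform (A t) (D_ (p t)) (B_ (p t)) k.
    apply: cvgB; apply: cvgM => //.
    + by apply: jointB; rewrite k2 leqnn.
    + by apply: cvgV => //; exact: A_neq0.
    + by apply: jointD; lia.
  have E : 2 * A t * Fform (A t) (D_ (p t)) (B_ (p t)) k * (Q_ (p t) 2 - Q_ (p t) 2) = 0.
    by rewrite subrr mulr0.
  rewrite -[X in _ --> X]E.
  have c2 : (fun=> 2) @ filter_prod (\oo : set_system nat) (within I (nbhs t)) --> (2 : R).
    exact: cvg_cst.
  apply: cvgM; last exact: (cvgB Q2 (jointQ 2%N k2)).
  by apply: cvgM cF; exact: cvgM c2 A2.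
Qed.

Lemma J_constant a b : I a -> I b -> J_ (p a) k = J_ (p b) k.
Proof. by apply: (quot0_constant (F := fun r => J_ (p r) k) iI) => t; exact: quot_J. Qed.

End solutions.

(** * Differentials of the functionals J_k *)
Section differential_of_Jform.
Variable R : realType.

Definition dEform (A : R) (D B : nat -> R) (a : R) (d b : nat -> R) j : R :=
  (b j / A - B j * a / A ^+ 2) + (a * D j + A * d j).
Definition dFform (A : R) (D B : nat -> R) (a : R) (d b : nat -> R) j : R :=
  (b j / A - B j * a / A ^+ 2) - (a * D j + A * d j).
Definition dJform (A : R) (D B Q : nat -> R) (a : R) (d b q : nat -> R) k : R :=
  dEform A D B a d b k - \sum_(2 <= j < k.+1) (q j * Q (k + 2 - j)%N + Q j * q (k + 2 - j)%N)
  + 4^-1 * \sum_(2 <= j < k)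
     ((dEform A D B a d b j * Eform A D B (k + 1 - j) +
       Eform A D B j * dEform A D B a d b (k + 1 - j))
      - (dFform A D B a d b j * Fform A D B (k + 1 - j) +
         Fform A D B j * dFform A D B a d b (k + 1 - j))).

Lemma Jform_is_derive (A : R -> R) (D B Q : nat -> R -> R) a d b q t k : (2 <= k)%N ->
    A t != 0 -> is_derive t 1 A a ->
    (forall j, (2 <= j <= k)%N -> [/\ is_derive t 1 (D j) (d j),
       is_derive t 1 (B j) (b j) & is_derive t 1 (Q j) (q j)]) ->
  is_derive t 1 (fun r => Jform (A r) (D ^~ r) (B ^~ r) (Q ^~ r) k)
    (dJform (A t) (D ^~ t) (B ^~ t) (Q ^~ t) a d b q k).
Proof.
move=> k2 A0 dA H.
have dB j : (2 <= j <= k)%N -> is_derive t 1 (fun r => B j r / A r)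
    (b j / A t - B j t * a / A t ^+ 2).
  move=> /H[_ dB _]; apply: (is_derive_eq (derM dB (derV A0 dA))).
  by rewrite mulNr mulrN mulrA.
have dE j : (2 <= j <= k)%N -> is_derive t 1 (fun r => Eform (A r) (D ^~ r) (B ^~ r) j)
    (dEform (A t) (D ^~ t) (B ^~ t) a d b j).
  by move=> jk; have [dD _ _] := H j jk; exact: (derD (dB j jk) (derM dA dD)).
have dF j : (2 <= j <= k)%N -> is_derive t 1 (fun r => Fform (A r) (D ^~ r) (B ^~ r) j)
    (dFform (A t) (D ^~ t) (B ^~ t) a d b j).
  by move=> jk; have [dD _ _] := H j jk; exact: (derB (dB j jk) (derM dA dD)).
apply: derD; last first.
  apply: derZ; apply: der_sum_nat => j jk.
  have j1 : (2 <= j <= k)%N by lia.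
  have j2 : (2 <= k + 1 - j <= k)%N by lia.
  exact: (derB (derM (dE _ j1) (dE _ j2)) (derM (dF _ j1) (dF _ j2))).
apply: derB; first by apply: dE; rewrite k2 leqnn.
apply: der_sum_nat => j jk.
have [|_ _ q1] := H j; first by lia.
have [|_ _ q2] := H (k + 2 - j)%N; first by lia.
exact: derM q1 q2.
Qed.

End differential_of_Jform.

Section bilinear_form.
Variables (R : realType) (n : nat).
Implicit Types (u v w a b : tpoint R n -> R).
Local Notation mu := (torus_measure R n).

Definition ndot k u v : R := \int[mu]_x nabla_dot k u v x.

Lemma ndotC k u v : (0 < k)%N -> sobolev k u -> sobolev k v -> ndot k u v = ndot k v u.
Proof.
move=> k0 su sv; have c := nabla_dot_cvg k0 su sv; apply: (cvg_unique _ c) => //.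
rewrite (_ : (fun N => bform k N u v) = (fun N => bform k N v u)); first exact: nabla_dot_cvg.
by apply/funext => N; exact: bformC.
Qed.

Lemma ndotDZ k c u v w : (0 < k)%N -> sobolev k u -> sobolev k v -> sobolev k w ->
  ndot k (fun x => u x + c * v x) w = ndot k u w + c * ndot k v w.
Proof.
move=> k0 su sv sw; have sZ := sobolevZ c sv; have sS := sobolevD su sZ.
have l := nabla_dot_cvg k0 sS sw; apply: (cvg_unique _ l) => //.
have hu := sobolev_L2 su; have hv := sobolev_L2 sv; have hZ := sobolev_L2 sZ.
rewrite (_ : (fun N => bform k N _ w) = (fun N => bform k N u w + c * bform k N v w)); last first.
  by apply/funext => N; rewrite bformDl// bformZl.
apply: cvgD; first exact: nabla_dot_cvg.
by apply: cvgM; [exact: cvg_cst|exact: nabla_dot_cvg].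
Qed.

(** Along a line a bilinear form is a quadratic polynomial in [t]. *)
Lemma ndot_along k t u v a b : (0 < k)%N ->
    sobolev k u -> sobolev k v -> sobolev k a -> sobolev k b ->
  ndot k (fun x => u x + t * a x) (fun x => v x + t * b x) =
  ndot k u v + (t * (ndot k u b + ndot k a v) + t * (t * ndot k a b)).
Proof.
move=> k0 su sv sa sb; have sS := sobolevD sv (sobolevZ t sb).
rewrite ndotDZ// ndotC// ndotDZ// [ndot k a _]ndotC// ndotDZ//.
rewrite (ndotC k0 sv su) (ndotC k0 sb su) (ndotC k0 sv sa) (ndotC k0 sb sa); ring.
Qed.

Lemma ndot_derive k u v a b : (0 < k)%N ->
    sobolev k u -> sobolev k v -> sobolev k a -> sobolev k b ->
  is_derive (0 : R) 1 (fun t => ndot k (fun x => u x + t * a x) (fun x => v x + t * b x))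
    (ndot k u b + ndot k a v).
Proof.
move=> k0 su sv sa sb; under eq_fun do rewrite ndot_along//.
have di : is_derive (0 : R) 1 (fun t : R => t) 1 by exact: is_derive_id.
have dc (c : R) : is_derive (0 : R) 1 (fun=> c) 0 by exact: is_derive_cst.
apply: (is_derive_eq (derD (dc _) (derD (derM di (dc _)) (derM di (derM di (dc _)))))).
by ring.
Qed.

Lemma ndot0 k u : (0 < k)%N -> sobolev k u -> ndot k u (cst 0) = 0.
Proof.
move=> k0 su; have E : (cst 0 : tpoint R n -> R) = (fun x => u x + -1 * u x).
  by apply/funext => x; rewrite mulN1r subrr.
rewrite ndotC//; last exact: sobolev0.
by rewrite E ndotDZ//; lra.
Qed.

End bilinear_form.

Section differential_of_J.
Variables (R : realType) (n : nat) (K : nat) (p h : state R n).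
Hypotheses (pp : phase_space K p) (ph : phase_space K h).

Let dD1 : R := ndot 1 p.1 h.1 + ndot 1 h.1 p.1.

(** The differential of J_k in any direction, from the chain rule
    [Jform_is_derive]. *)
Lemma J_along_derive k : (2 <= k <= K)%N ->
  is_derive (0 : R) 1 (fun t : R => J_ (along p h t) k)
    (dJform (A_ p) (D_ p) (B_ p) (Q_ p) (- dD1 / (1 + D_ p 1) ^+ 2)
      (fun j => ndot j p.1 h.1 + ndot j h.1 p.1)
      (fun j => ndot j.-1 p.2 h.2 + ndot j.-1 h.2 p.2)
      (fun j => ndot j.-1 p.1 h.2 + ndot j.-1 h.1 p.2) k).
Proof.
move=> kK; have [su sv] := pp; have [sa sb] := ph.
have sobu j : (j <= K)%N -> sobolev j p.1 by move=> jK; exact: sobolevS su.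
have soba j : (j <= K)%N -> sobolev j h.1 by move=> jK; exact: sobolevS sa.
have sobv j : (j <= K.-1)%N -> sobolev j p.2 by move=> jK; exact: sobolevS sv.
have sobb j : (j <= K.-1)%N -> sobolev j h.2 by move=> jK; exact: sobolevS sb.
have p0 : along p h 0 = p.
  by rewrite /along; case: (p) => u v /=; congr (_, _); apply/funext => x; rewrite mul0r addr0.
have dD j : (1 <= j <= K)%N -> is_derive (0 : R) 1 (fun t : R => D_ (along p h t) j)
    (ndot j p.1 h.1 + ndot j h.1 p.1).
  by move=> jK; apply: ndot_derive; [lia|apply: sobu|apply: sobu|apply: soba|apply: soba]; lia.
have D1n : 1 + D_ (along p h 0) 1 != 0.
  by rewrite p0 gt_eqF// ltr_pwDl//; exact: D1_ge0 pp.
have dA : is_derive (0 : R) 1 (fun t : R => A_ (along p h t)) (- dD1 / (1 + D_ p 1) ^+ 2).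
  have d1 : is_derive (0 : R) 1 (fun t : R => D_ (along p h t) 1) dD1 by apply: dD; lia.
  have d1' : is_derive (0 : R) 1 (fun t : R => 1 + D_ (along p h t) 1) (0 + dD1).
    by apply: derD => //; exact: is_derive_cst.
  by have := @derV R (fun t : R => 1 + D_ (along p h t) 1) 0 _ D1n d1'; rewrite add0r p0.
have A0 : A_ (along p h 0) != 0 by rewrite invr_eq0.
have k2 : (2 <= k)%N by lia.
have := @Jform_is_derive R (fun t => A_ (along p h t)) (fun j t => D_ (along p h t) j)
  (fun j t => B_ (along p h t) j) (fun j t => Q_ (along p h t) j) _
  (fun j => ndot j p.1 h.1 + ndot j h.1 p.1)
  (fun j => ndot j.-1 p.2 h.2 + ndot j.-1 h.2 p.2)
  (fun j => ndot j.-1 p.1 h.2 + ndot j.-1 h.1 p.2) 0 k k2 A0 dA.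
rewrite p0; apply => j jk; split.
- by apply: dD; lia.
- by apply: ndot_derive; [lia|apply: sobv|apply: sobv|apply: sobb|apply: sobb]; lia.
- by apply: ndot_derive; [lia|apply: sobu|apply: sobv|apply: soba|apply: sobb]; lia.
Qed.

End differential_of_J.

(** * Variations of the velocity by one Fourier mode *)
Section trigonometric_directions.
Variables (R : realType) (n : nat).
Implicit Types (m p : freq n) (u v w : tpoint R n -> R).
Local Notation mu := (torus_measure R n).
Local Notation vol := (vol R n).
Local Notation lam := (@freq_sqr R n).
Local Notation fc := (@fourier_cos R n).
Local Notation fs := (@fourier_sin R n).

Lemma fourier_cos_cosf m p : fc (cosf m) p = 2^-1 * ((p == m)%:R + (p == - m)%:R).
Proof.
rewrite fourier_cosE ip_cos_cos [m == p]eq_sym [m == - p]eq_sym eqr_oppLR.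
by have := vol_neq0 R n; set V := vol => V0; field.
Qed.

Lemma fourier_sin_cosf m p : fs (cosf m) p = 0.
Proof. by rewrite fourier_sinE ipC ip_sin_cos mulr0. Qed.

Lemma fourier_cos_sinf m p : fc (sinf m) p = 0.
Proof. by rewrite fourier_cosE ip_sin_cos mulr0. Qed.

Lemma fourier_sin_sinf m p : fs (sinf m) p = 2^-1 * ((p == m)%:R - (p == - m)%:R).
Proof.
rewrite fourier_sinE ip_sin_sin [m == p]eq_sym [m == - p]eq_sym eqr_oppLR.
by have := vol_neq0 R n; set V := vol => V0; field.
Qed.

(** Only the frequencies m and - m occur in the sums over boxes. *)
Lemma sobolev_one_mode s w m : w \in Lfun mu 2%:E ->
  (forall p, cross w w p <= (p == m)%:R + (p == - m)%:R) -> sobolev s w.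
Proof.
move=> hw cw; apply/sobolevP; split => //; exists (2 * (1 + lam m) ^+ s) => N.
apply: (@le_trans _ _ (\sum_(p <- box n N) ((1 + lam p) ^+ s * (p == m)%:R
    + (1 + lam p) ^+ s * (p == - m)%:R))).
  apply: ler_sum => p _; rewrite -mulrDr; apply: ler_wpM2l => //.
  by rewrite exprn_ge0// addr_ge0// lam_ge0.
have l0 : 0 <= (1 + lam m) ^+ s by rewrite exprn_ge0// addr_ge0// lam_ge0.
by rewrite big_split /= !box_sum1 lam_opp; case: ifP => _; case: ifP => _; lra.
Qed.

Lemma sobolev_cosf s m : sobolev s (@cosf R n m).
Proof.
apply: (@sobolev_one_mode s _ m); first exact: L2_cos.
move=> p; rewrite /cross fourier_cos_cosf fourier_sin_cosf.
by case: eqP => _; case: eqP => _; rewrite ?mulr1n ?mulr0n; lra.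
Qed.

Lemma sobolev_sinf s m : sobolev s (@sinf R n m).
Proof.
apply: (@sobolev_one_mode s _ m); first exact: L2_sin.
move=> p; rewrite /cross fourier_cos_sinf fourier_sin_sinf.
by case: eqP => _; case: eqP => _; rewrite ?mulr1n ?mulr0n; lra.
Qed.

(** The frequencies m and - m contribute equally; hence no factor 1/2. *)
Lemma ndot_cosf k u m : (0 < k)%N -> sobolev k u ->
  ndot k u (cosf m) = lam m ^+ k * (vol * fc u m).
Proof.
move=> k0 su; have l := nabla_dot_cvg k0 su (sobolev_cosf k m).
have [sc _] := fourier_sym (sobolev_L2 su).
have [N0 mN0] := mem_box_ex m.
apply: (cvg_unique _ l) => //; apply: cvg_near_cst; near=> N.
have mN : m \in box n N by apply: mem_box_le mN0; near: N; exact: nbhs_infty_ge.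
rewrite /bform (eq_bigr (fun p => 2^-1 * (lam p ^+ k * fc u p * (p == m)%:R
     + lam p ^+ k * fc u p * (p == - m)%:R))); last first.
  by move=> p _; rewrite /cross fourier_cos_cosf fourier_sin_cosf; ring.
by rewrite -mulr_sumr big_split /= !box_sum1 box_opp mN lam_opp sc; field.
Unshelve. all: by end_near. Qed.

Lemma ndot_sinf k u m : (0 < k)%N -> sobolev k u ->
  ndot k u (sinf m) = lam m ^+ k * (vol * fs u m).
Proof.
move=> k0 su; have l := nabla_dot_cvg k0 su (sobolev_sinf k m).
have [_ ss] := fourier_sym (sobolev_L2 su).
have [N0 mN0] := mem_box_ex m.
apply: (cvg_unique _ l) => //; apply: cvg_near_cst; near=> N.
have mN : m \in box n N by apply: mem_box_le mN0; near: N; exact: nbhs_infty_ge.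
rewrite /bform (eq_bigr (fun p => 2^-1 * (lam p ^+ k * fs u p * (p == m)%:R
     - lam p ^+ k * fs u p * (p == - m)%:R))); last first.
  by move=> p _; rewrite /cross fourier_cos_sinf fourier_sin_sinf; ring.
by rewrite -mulr_sumr sumrB /= !box_sum1 box_opp mN lam_opp ss; field.
Unshelve. all: by end_near. Qed.

End trigonometric_directions.

Section velocity_polynomial.
Variables (R : realType) (A : R) (D Q : nat -> R).

(** The velocity coefficient of a mode with frequency^2 = x is multiplied by
    (velpoly k).[x] in the differential of J_k, its position coefficient by
    [pospart k x]. *)
Definition velpoly k : {poly R} :=
  (2 / A) *: 'X^(k.-1) + \sum_(2 <= j < k) (D (k + 1 - j)%N *: 'X^(j.-1) + D j *: 'X^(k - j)).

Definition pospart k (x : R) : R :=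
  - \sum_(2 <= j < k.+1) (x ^+ j.-1 * Q (k + 2 - j)%N + Q j * x ^+ (k + 1 - j)).

Lemma velpoly_coef_ge k i : (2 <= k)%N -> (k <= i)%N -> (velpoly k)`_i = 0.
Proof.
move=> k2 ki; rewrite coefD coefZ coefXn (_ : (i == k.-1) = false); last by lia.
rewrite mulr0 add0r coef_sum big_nat big1// => j jk.
rewrite coefD !coefZ !coefXn (_ : (i == j.-1) = false); last by lia.
by rewrite (_ : (i == k - j)%N = false) ?mulr0 ?addr0//; lia.
Qed.

Lemma velpoly_lead k : (2 <= k)%N -> (velpoly k)`_k.-1 = 2 / A.
Proof.
move=> k2; rewrite coefD coefZ coefXn eqxx mulr1 coef_sum big_nat big1 ?addr0// => j jk.
rewrite coefD !coefZ !coefXn (_ : (k.-1 == j.-1) = false); last by lia.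
by rewrite (_ : (k.-1 == k - j)%N = false) ?mulr0 ?addr0//; lia.
Qed.

(** As E_j - F_j = 2 A D_j, the B_j drop out of the coefficient of [V]. *)
Lemma dJform_velocity B k x U V (d b q : nat -> R) : (2 <= k)%N -> A != 0 ->
    (forall j, (2 <= j <= k)%N ->
       [/\ d j = 0, b j = 2 * (x ^+ j.-1 * V) & q j = x ^+ j.-1 * U]) ->
  dJform A D B Q 0 d b q k = V * (velpoly k).[x] + U * pospart k x.
Proof.
move=> k2 A0 H.
have dE j : (2 <= j <= k)%N -> dEform A D B 0 d b j = 2 * (x ^+ j.-1 * V) / A.
  by move=> /H[dj bj _]; rewrite /dEform dj bj; field.
have dF j : (2 <= j <= k)%N -> dFform A D B 0 d b j = 2 * (x ^+ j.-1 * V) / A.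
  by move=> /H[dj bj _]; rewrite /dFform dj bj; field.
have EF j : Eform A D B j - Fform A D B j = 2 * A * D j by rewrite /Eform /Fform; ring.
have s1 : \sum_(2 <= j < k.+1) (q j * Q (k + 2 - j)%N + Q j * q (k + 2 - j)%N) =
    U * - pospart k x.
  rewrite /pospart opprK mulr_sumr !big_nat; apply: eq_bigr => j jk.
  have [|_ _ ->] := H j; first by lia.
  have [|_ _ ->] := H (k + 2 - j)%N; first by lia.
  by rewrite (_ : (k + 2 - j).-1 = k + 1 - j)%N; [ring|lia].
rewrite /dJform s1 dE ?k2 ?leqnn// /velpoly hornerD hornerZ hornerXn horner_sum.
rewrite mulrDr !mulr_sumr.
have -> : \sum_(2 <= j < k) 4^-1 * ((dEform A D B 0 d b j * Eform A D B (k + 1 - j) +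
       Eform A D B j * dEform A D B 0 d b (k + 1 - j))
      - (dFform A D B 0 d b j * Fform A D B (k + 1 - j) +
         Fform A D B j * dFform A D B 0 d b (k + 1 - j))) =
  \sum_(2 <= j < k) V * (D (k + 1 - j)%N *: 'X^(j.-1) + D j *: 'X^(k - j)).[x].
  rewrite !big_nat; apply: eq_bigr => j jk.
  rewrite !dE ?dF; [|lia..].
  rewrite hornerD !hornerZ !hornerXn (_ : (k + 1 - j).-1 = k - j)%N; last by lia.
  set y := x ^+ j.-1; set z := x ^+ (k - j).
  have -> : 2 * (y * V) / A * Eform A D B (k + 1 - j) + Eform A D B j * (2 * (z * V) / A) -
      (2 * (y * V) / A * Fform A D B (k + 1 - j) + Fform A D B j * (2 * (z * V) / A)) =
      2 * (y * V) / A * (Eform A D B (k + 1 - j) - Fform A D B (k + 1 - j)) +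
      (Eform A D B j - Fform A D B j) * (2 * (z * V) / A) by ring.
  by rewrite !EF; field.
set S := \sum_(2 <= j < k) _.
by field.
Qed.

End velocity_polynomial.

(** * Independence *)
Section independence.
Variables (R : realType) (n : nat).
Hypothesis hn : (1 <= n)%N.
Implicit Types (m : freq n) (u v w : tpoint R n -> R) (p q h : state R n).
Local Notation mu := (torus_measure R n).
Local Notation vol := (vol R n).
Local Notation lam := (@freq_sqr R n).
Local Notation fc := (@fourier_cos R n).
Local Notation fs := (@fourier_sin R n).

(** Frequencies along the first axis, chosen for their distinct lengths. *)
Definition axis_freq (l : nat) : freq n :=
  [ffun i : 'I_n => if (i : nat) == 0%N then l%:Z else 0].

Lemma lam_axis_freq l : lam (axis_freq l) = l%:R ^+ 2.
Proof.
rewrite /freq_sqr (bigD1 (Ordinal hn))//= ffunE /= big1 ?addr0//.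
move=> i ine; rewrite ffunE; case: eqP => [i0|_]; last by rewrite mulr0z expr0n.
by case/eqP: ine; exact: val_inj.
Qed.

Lemma axis_freq_inj l l' : axis_freq l = axis_freq l' -> l = l'.
Proof. by move/ffunP/(_ (Ordinal hn)); rewrite !ffunE /= => -[]. Qed.

Lemma axis_freqN l l' : (0 < l)%N -> axis_freq l != - axis_freq l'.
Proof.
move=> l0; apply/eqP => /ffunP/(_ (Ordinal hn)); rewrite !ffunE /= => E.
by move: l0; have := E; lia.
Qed.

(** The Wronskian of the Fourier modes of position and velocity: where it does
    not vanish, position and velocity are not real multiples of one another. *)
Definition wronskian p m : R := fc p.1 m * fs p.2 m - fs p.1 m * fc p.2 m.

Section at_a_state.
Variables (K : nat) (p : state R n).
Hypotheses (K2 : (2 <= K)%N) (pp : phase_space K p).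
Local Notation V k := (velpoly (A_ p) (D_ p) k).
Local Notation S k := (pospart (Q_ p) k).

Let A0 : A_ p != 0.
Proof. by rewrite invr_eq0 gt_eqF// ltr_pwDl//; exact: D1_ge0 pp. Qed.

(** The direction [w] enters only through its pairings with position and velocity,
    so that cosines and sines of one frequency, which have the same x, are treated
    alike. *)
Let dJ_velocity k w x a b : (2 <= k <= K)%N -> sobolev K.-1 w ->
    (forall j, (0 < j < K)%N ->
       ndot j p.2 w = x ^+ j * a /\ ndot j p.1 w = x ^+ j * b) ->
  derive1 (fun t : R => J_ (along p (cst 0, w) t) k) 0 = a * (V k).[x] + b * S k x.
Proof.
move=> kK sw H; have ph : phase_space K (cst 0, w) by split => //; exact: sobolev0.
have [su sv] := pp.
have sobu j : (j <= K)%N -> sobolev j p.1 by move=> jK; exact: sobolevS su.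
have sobv j : (j <= K.-1)%N -> sobolev j p.2 by move=> jK; exact: sobolevS sv.
have sobw j : (j <= K.-1)%N -> sobolev j w by move=> jK; exact: sobolevS sw.
have z1 j : (0 < j <= K)%N -> ndot j p.1 (cst 0) + ndot j (cst 0) p.1 = 0.
  move=> jK; have sj : sobolev j p.1 by apply: sobu; lia.
  by rewrite [ndot j (cst 0) _]ndotC ?ndot0 ?addr0//; [lia|lia|exact: sobolev0].
rewrite derive1E (@derive_val _ _ _ _ _ _ _ (J_along_derive pp ph kK)) /=.
rewrite z1 ?oppr0 ?mul0r; last by lia.
apply: dJform_velocity => //; first by lia.
move=> j jk; split; first by apply: z1; lia.
- rewrite [ndot _ w _]ndotC; [|lia|apply: sobw; lia|apply: sobv; lia].
  by have [|-> _] := H j.-1; [lia|rewrite mulr2n mulrDl mul1r].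
- rewrite [ndot _ (cst 0) _]ndotC; [|lia|exact: sobolev0|apply: sobv; lia].
  rewrite ndot0 ?addr0; [|lia|apply: sobv; lia].
  by have [|_ ->] := H j.-1; first by lia.
Qed.

(** At a frequency with nonzero Wronskian the two equations from the cosine and the
    sine give a root of the combination of the velocity polynomials; there are too
    many roots, and the polynomials have distinct degrees. *)
Lemma independent_wronskian :
  (forall l, (1 <= l <= K)%N -> wronskian p (axis_freq l) != 0) -> independent_at K p.
Proof.
move=> W; split=> [k h kK ph|c Hc k].
  by have [] := J_along_derive pp ph kK.
have [su sv] := pp.
pose P := \sum_(2 <= k < K.+1) c k *: V k.
have rootP l : (1 <= l <= K)%N -> root P (l%:R ^+ 2).
  move=> lK; set m := axis_freq l; set x := l%:R ^+ 2.
  have lamm : lam m = x by exact: lam_axis_freq.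
  have sobu j : (j < K)%N -> sobolev j p.1 by move=> jK; apply: sobolevS su; lia.
  have sobv j : (j < K)%N -> sobolev j p.2 by move=> jK; apply: sobolevS sv; lia.
  pose Sx := \sum_(2 <= k < K.+1) c k * S k x.
  have lin a b w : sobolev K.-1 w -> (forall j, (0 < j < K)%N ->
       ndot j p.2 w = x ^+ j * a /\ ndot j p.1 w = x ^+ j * b) -> a * P.[x] + b * Sx = 0.
    move=> sw H; have ph : phase_space K ((cst 0, w) : state R n).
      by split => //; exact: sobolev0.
    rewrite -(Hc _ ph) /P /Sx horner_sum !mulr_sumr -big_split !big_nat.
    apply: eq_bigr => j jK /=.
    by rewrite (dJ_velocity _ sw H) ?hornerZ; [ring|lia].
  have hcos : vol * fc p.2 m * P.[x] + vol * fc p.1 m * Sx = 0.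
    apply: (lin _ _ (cosf m)); first exact: sobolev_cosf.
    by move=> j /andP[j0 jK]; rewrite !ndot_cosf ?lamm//; [exact: sobu|exact: sobv].
  have hsin : vol * fs p.2 m * P.[x] + vol * fs p.1 m * Sx = 0.
    apply: (lin _ _ (sinf m)); first exact: sobolev_sinf.
    by move=> j /andP[j0 jK]; rewrite !ndot_sinf ?lamm//; [exact: sobu|exact: sobv].
  have E : vol * (wronskian p m * P.[x]) = 0.
    transitivity (fc p.1 m * (vol * fs p.2 m * P.[x] + vol * fs p.1 m * Sx)
       - fs p.1 m * (vol * fc p.2 m * P.[x] + vol * fc p.1 m * Sx)).
      by rewrite /wronskian; ring.
    by rewrite hcos hsin !mulr0 subrr.
  move/eqP: E; rewrite !mulf_eq0 (negbTE (vol_neq0 R n)) (negbTE (W l lK)) /=.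
  by move=> /eqP E; apply/rootP.
have sP : (size P <= K)%N.
  apply/leq_sizeP => i Ki; rewrite coef_sum big_nat big1// => j jK.
  by rewrite coefZ velpoly_coef_ge ?mulr0//; lia.
have P0 : P = 0.
  apply/eqP/contraT => Pn0; have := @max_poly_roots _ P [seq (l%:R : R) ^+ 2 | l <- iota 1 K] Pn0.
  rewrite size_map size_iota ltnNge sP; apply.
    by apply/allP => y /mapP[l]; rewrite mem_iota => lK ->; apply: rootP; lia.
  rewrite map_inj_uniq ?iota_uniq// => l l' /eqP.
  by rewrite -!natrX eqr_nat eqn_exp2r// => /eqP.
suff ck : forall d j, (2 <= j <= K)%N -> (K - j = d)%N -> c j = 0 by move=> kK; exact: ck kK erefl.
elim/ltn_ind => d IH j jK jd.
(* by induction only c_j contributes to the coefficient of degree j - 1 *)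
have Pj : P`_j.-1 = 0 by rewrite P0 coef0.
move: Pj; rewrite coef_sum (bigD1_seq j) ?iota_uniq//= ?mem_index_iota; last by lia.
rewrite big_seq_cond big1 ?addr0; last first.
  move=> i; rewrite mem_index_iota => /andP[iK ij]; rewrite coefZ.
  have [ji|ji] := ltnP j i; first by rewrite (IH (K - i)%N _ i) ?mul0r//; lia.
  by rewrite velpoly_coef_ge ?mulr0//; lia.
rewrite coefZ velpoly_lead; last by lia.
by move/eqP; rewrite !mulf_eq0 invr_eq0 (negbTE A0) pnatr_eq0 /= orbF => /eqP.
Qed.

End at_a_state.

(** A Wronskian depends on four Fourier coefficients, each of which is continuous for
    the distance of the phase space. *)
Lemma wronskian_open K p m : phase_space K p -> wronskian p m != 0 ->
  exists2 e : R, 0 < e & forall q, phase_space K q ->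
    (phase_dist_sqr K q p < e%:E)%E -> wronskian q m != 0.
Proof.
move=> [su sv] W0.
(* a change of the four coefficients by at most dl <= 1 changes the Wronskian by at
   most dl * M *)
pose M : R := `|fc p.1 m| + `|fs p.2 m| + `|fs p.1 m| + `|fc p.2 m| + 2.
have M2 : 2 <= M by rewrite lerDr !addr_ge0.
have M0 : 0 < M by lra.
pose dl : R := Num.min 1 (`|wronskian p m| / (2 * M)).
have d0 : 0 < dl by rewrite lt_min ltr01 divr_gt0 ?normr_gt0// mulr_gt0.
have d1 : dl <= 1 by rewrite ge_min lexx.
have dM : dl * M < `|wronskian p m|.
  have : dl <= `|wronskian p m| / (2 * M) by rewrite ge_min lexx orbT.
  have Wp : 0 < `|wronskian p m| by rewrite normr_gt0.
  by rewrite ler_pdivlMr ?mulr_gt0//; lra.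
exists (dl ^+ 2); first by rewrite exprn_gt0.
move=> q [su' sv'] dist.
have L2 s (w : tpoint R n -> R) : sobolev s w -> w \in Lfun mu 2%:E by exact: sobolev_L2.
have small (x : R) : x ^+ 2 <= dl ^+ 2 -> `|x| <= dl.
  by move=> h; rewrite -(ler_pXn2r (ltn0Sn 1)) ?nnegrE ?(ltW d0)// real_normK ?num_real.
have part s (w w' : tpoint R n -> R) : sobolev s w -> sobolev s w' ->
    (sobolev_sqr s (fun x => w' x - w x)%R <= phase_dist_sqr K q p)%E ->
    `|fc w' m - fc w m| <= dl /\ `|fs w' m - fs w m| <= dl.
  move=> sw sw' le.
  have := cross_le_sobolev s (fun x => w' x - w x) m => /le_trans/(_ le).
  move=> /le_lt_trans/(_ dist); rewrite lte_fin => /ltW.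
  rewrite /cross fourier_cosB ?fourier_sinB ?(L2 _ _ sw) ?(L2 _ _ sw')//.
  rewrite -!expr2 => h; split; apply: small; apply: le_trans h.
    by rewrite lerDl sqr_ge0.
  by rewrite lerDr sqr_ge0.
have [|hu1 hu2] := part K p.1 q.1 su su'; first by rewrite leeDl// sobolev_sqr_ge0.
have [|hv1 hv2] := part K.-1 p.2 q.2 sv sv'; first by rewrite leeDr// sobolev_sqr_ge0.
have mulle (x y : R) : `|x| <= dl -> `|x * y| <= dl * `|y|.
  by move=> h; rewrite normrM ler_wpM2r.
have mulle2 (x y : R) : `|x| <= dl -> `|y| <= dl -> `|x * y| <= dl.
  move=> h h'; apply: le_trans (mulle _ y h) _.
  by rewrite ler_piMr ?(ltW d0)// (le_trans h').
apply/eqP => Wq0; move: dM; rewrite ltNge => /negP; apply.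
have E : - wronskian p m =
   (fc q.1 m - fc p.1 m) * fs p.2 m + (fs q.2 m - fs p.2 m) * fc p.1 m
   + (fc q.1 m - fc p.1 m) * (fs q.2 m - fs p.2 m)
   - (fs q.1 m - fs p.1 m) * fc p.2 m - (fc q.2 m - fc p.2 m) * fs p.1 m
   - (fs q.1 m - fs p.1 m) * (fc q.2 m - fc p.2 m).
  by rewrite -[LHS]add0r -Wq0 /wronskian; ring.
rewrite -normrN E.
apply: le_trans (ler_normB _ _) _; apply: le_trans (lerD (ler_normB _ _) (lexx _)) _.
apply: le_trans (lerD (lerD (ler_normB _ _) (lexx _)) (lexx _)) _.
apply: le_trans (lerD (lerD (lerD (ler_normD _ _) (lexx _)) (lexx _)) (lexx _)) _.
apply: le_trans (lerD (lerD (lerD (lerD (ler_normD _ _) (lexx _)) (lexx _)) (lexx _)) (lexx _)) _.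
have h1 := mulle _ (fs p.2 m) hu1; have h2 := mulle _ (fc p.1 m) hv2.
have h3 := mulle2 _ _ hu1 hv2; have h4 := mulle _ (fc p.2 m) hu2.
have h5 := mulle _ (fs p.1 m) hv1; have h6 := mulle2 _ _ hu2 hv1.
apply: le_trans (lerD (lerD (lerD (lerD (lerD h1 h2) h3) h4) h5) h6) _.
by rewrite le_eqVlt; apply/orP; left; apply/eqP; rewrite /M; ring.
Qed.

End independence.

(** A nonzero polynomial cannot vanish at all the points d / 2, d / 3, ..., which are
    more numerous than its roots. *)
Lemma small_nonroot (R : realFieldType) (P : {poly R}) (d : R) : P != 0 -> 0 < d ->
  exists2 x, 0 < x < d & ~~ root P x.
Proof.
move=> P0 d0; pose rs := [seq d / (i%:R : R) | i <- iota 2 (size P)].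
have rs_inj : uniq rs.
  rewrite map_inj_in_uniq ?iota_uniq// => i j _ _ /(mulfI (lt0r_neq0 d0)) /invr_inj /eqP.
  by rewrite eqr_nat => /eqP.
have /allPn[x /mapP[i]] : ~~ all (root P) rs.
  apply/negP => rP; have := max_poly_roots P0 rP rs_inj.
  by rewrite size_map size_iota ltnn.
rewrite mem_iota => /andP[i2 _] -> nroot; exists (d / i%:R); last exact: nroot.
have i0 : 0 < i%:R :> R by rewrite ltr0n; lia.
by rewrite divr_gt0//= ltr_pdivrMr// ltr_pMr// ltr1n.
Qed.

Section open_dense.
Variables (R : realType) (n : nat).
Hypothesis hn : (1 <= n)%N.
Implicit Types (m : freq n) (u v w : tpoint R n -> R) (p q h : state R n).
Local Notation mu := (torus_measure R n).
Local Notation fc := (@fourier_cos R n).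
Local Notation fs := (@fourier_sin R n).

Lemma fourier_cos_sum (I : Type) (s : seq I) (F : I -> tpoint R n -> R) m :
  (forall i, F i \in Lfun mu 2%:E) ->
  fc (fun x => \sum_(i <- s) F i x) m = \sum_(i <- s) fc (F i) m.
Proof.
by move=> hF; rewrite fourier_cosE ip_suml ?mulr_sumr//; exact: L2_cos.
Qed.

Lemma fourier_sin_sum (I : Type) (s : seq I) (F : I -> tpoint R n -> R) m :
  (forall i, F i \in Lfun mu 2%:E) ->
  fs (fun x => \sum_(i <- s) F i x) m = \sum_(i <- s) fs (F i) m.
Proof.
by move=> hF; rewrite fourier_sinE ip_suml ?mulr_sumr//; exact: L2_sin.
Qed.

Lemma sobolev_sum (I : Type) (s : seq I) (F : I -> tpoint R n -> R) r :
  (forall i, sobolev r (F i)) -> sobolev r (fun x => \sum_(i <- s) F i x).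
Proof.
move=> hF; elim: s => [|i s IH].
  by under eq_fun do rewrite big_nil; exact: sobolev0.
by under eq_fun do rewrite big_cons; exact: sobolevD.
Qed.

(** A direction in which all the Wronskians under consideration grow
    quadratically, see [wronskian_probe]. *)
Definition probe K : state R n :=
  (fun x => \sum_(l <- iota 1 K) cosf (axis_freq n l) x,
   fun x => \sum_(l <- iota 1 K) sinf (axis_freq n l) x).

Lemma probe_phase_space K s : phase_space s (probe K).
Proof.
by split; apply: sobolev_sum => l; [exact: sobolev_cosf|exact: sobolev_sinf].
Qed.

Lemma probe_fourier K l : (1 <= l <= K)%N ->
  [/\ fc (probe K).1 (axis_freq n l) = 2^-1, fs (probe K).1 (axis_freq n l) = 0,
      fc (probe K).2 (axis_freq n l) = 0 & fs (probe K).2 (axis_freq n l) = 2^-1].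
Proof.
move=> lK; have [c s] := (fun l => L2_cos R (axis_freq n l), fun l => L2_sin R (axis_freq n l)).
have li : l \in iota 1 K by rewrite mem_iota; lia.
have eqE l' : ((axis_freq n l == axis_freq n l') = (l == l'))%N.
  by apply/eqP/eqP => [/(axis_freq_inj hn)|->].
have neqE l' : (axis_freq n l == - axis_freq n l') = false.
  by apply/negbTE/(axis_freqN hn); lia.
have one (a : nat -> R) : (forall l', a l' = 2^-1 * (l == l')%:R) ->
    \sum_(l' <- iota 1 K) a l' = 2^-1.
  move=> aE; rewrite (bigD1_seq l) ?iota_uniq//= aE eqxx mulr1 big1 ?addr0// => l' ll'.
  by rewrite aE eq_sym (negbTE ll') mulr0.
split.
- by rewrite fourier_cos_sum//; apply: one => l'; rewrite fourier_cos_cosf eqE neqE addr0.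
- by rewrite fourier_sin_sum// big1// => l' _; rewrite fourier_sin_cosf.
- by rewrite fourier_cos_sum// big1// => l' _; rewrite fourier_cos_sinf.
- by rewrite fourier_sin_sum//; apply: one => l'; rewrite fourier_sin_sinf eqE neqE subr0.
Qed.

Lemma wronskian_probe K p t l : phase_space K p -> (1 <= l <= K)%N ->
  wronskian (along p (probe K) t) (axis_freq n l) =
  wronskian p (axis_freq n l)
  + (fc p.1 (axis_freq n l) + fs p.2 (axis_freq n l)) / 2 * t + 4^-1 * t ^+ 2.
Proof.
move=> [su sv] lK; have [gu gv] := probe_phase_space K 0.
have [E1 E2 E3 E4] := probe_fourier lK.
have [hu hv hgu hgv] := And4 (sobolev_L2 su) (sobolev_L2 sv) (sobolev_L2 gu) (sobolev_L2 gv).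
have hZu := L2Z t hgu; have hZv := L2Z t hgv.
rewrite /wronskian /along [X in X - _](_ : _ =
  (fc p.1 (axis_freq n l) + t * 2^-1) * (fs p.2 (axis_freq n l) + t * 2^-1)); last first.
  by rewrite fourier_cosD// fourier_sinD// fourier_cosZ// fourier_sinZ// E1 E4.
rewrite [X in _ - X](_ : _ = fs p.1 (axis_freq n l) * fc p.2 (axis_freq n l)); last first.
  by rewrite fourier_cosD// fourier_sinD// fourier_cosZ// fourier_sinZ// E2 E3 !mulr0 !addr0.
by field.
Qed.

Lemma sobolev_sqrZ_le s c w : sobolev s w ->
  (sobolev_sqr s (fun x => (c * w x)%R) <= (c ^+ 2 * fine (sobolev_sqr s w))%:E)%E.
Proof.
move=> [hw fw]; apply: sobolev_sqr_le => N; rewrite lee_fin.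
have le : \sum_(m <- box n N) sob_term s w m <= fine (sobolev_sqr s w).
  rewrite -lee_fin fineK ?box_le_sobolev// ge0_fin_numE//; exact: sobolev_sqr_ge0.
apply: le_trans (ler_wpM2l (sqr_ge0 c) le); rewrite mulr_sumr; apply: ler_sum => m _.
rewrite /sob_term /cross fourier_cosZ// fourier_sinZ// le_eqVlt; apply/orP; left.
by apply/eqP; ring.
Qed.

Lemma along_dist K p h t : phase_space K h ->
  (phase_dist_sqr K (along p h t) p <=
   (t ^+ 2 * (fine (sobolev_sqr K h.1) + fine (sobolev_sqr K.-1 h.2)))%:E)%E.
Proof.
move=> [sa sb]; rewrite /phase_dist_sqr /along /= mulrDr EFinD.
have E (f g : tpoint R n -> R) : (fun x => f x + t * g x - f x) = (fun x => t * g x).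
  by apply/funext => x; rewrite addrC addKr.
by rewrite !E; apply: leeD; exact: sobolev_sqrZ_le.
Qed.

(** A small step along [probe] that avoids the roots of the product of the quadratic
    polynomials of [wronskian_probe]. *)
Lemma wronskian_dense K p (e : R) : phase_space K p -> 0 < e ->
  exists q, [/\ phase_space K q, (phase_dist_sqr K q p < e%:E)%E &
    forall l, (1 <= l <= K)%N -> wronskian q (axis_freq n l) != 0].
Proof.
move=> pp e0; have pg := probe_phase_space K K.
set C := fine (sobolev_sqr K (probe K).1) + fine (sobolev_sqr K.-1 (probe K).2).
have C0 : 0 <= C by rewrite addr_ge0// fine_ge0// sobolev_sqr_ge0.
pose W l : {poly R} := (wronskian p (axis_freq n l))%:P
  + ((fc p.1 (axis_freq n l) + fs p.2 (axis_freq n l)) / 2) *: 'X + 4^-1 *: 'X^2.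
have W0 l : W l != 0.
  apply/eqP => /(congr1 (fun q : {poly R} => q`_2)).
  rewrite !coefD coefC !coefZ coefX coefXn coef0 /= mulr0 !add0r mulr1 => /eqP.
  by rewrite invr_eq0 pnatr_eq0.
have P0 : \prod_(l <- iota 1 K) W l != 0 by rewrite prodf_seq_neq0; apply/allP => l _; rewrite W0.
have d0 : 0 < Num.min 1 (e / (C + 1)) by rewrite lt_min ltr01 divr_gt0// ltr_wpDl.
have [t /andP[t0]] := small_nonroot P0 d0.
rewrite lt_min => /andP[t1 te] nr; exists (along p (probe K) t); split.
- have [su sv] := pp; have [gu gv] := pg.
  by split; apply: sobolevD => //; exact: sobolevZ.
- apply: le_lt_trans (along_dist p t pg) _; rewrite lte_fin.
  have tC : t * (C + 1) < e by rewrite -ltr_pdivlMr// ltr_wpDl.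
  apply: le_lt_trans tC; rewrite -/C expr2 -mulrA ler_wpM2l ?(ltW t0)//.
  by nra.
- move=> l lK; rewrite (wronskian_probe _ pp lK).
  move: nr; rewrite /root horner_prod prodf_seq_neq0 => /allP/(_ l).
  rewrite mem_iota => H; have := H _; rewrite /W !hornerE /=; apply.
  by lia.
Qed.

Lemma J_independentP K : (2 <= K)%N -> J_independent R n K.
Proof.
move=> K2; exists [set p | phase_space K p /\
  forall l, (1 <= l <= K)%N -> wronskian p (axis_freq n l) != 0]; split.
- by move=> p [].
- move=> p [pp W].
  suff H L : (L <= K)%N -> exists2 e : R, 0 < e & forall q, phase_space K q ->
      (phase_dist_sqr K q p < e%:E)%E ->
      forall l, (1 <= l <= L)%N -> wronskian q (axis_freq n l) != 0.
    have [e e0 He] := H K (leqnn K); exists e => // q pq dq.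
    by split => //; exact: He.
  elim: L => [_|L IH LK].
    by exists 1; [exact: ltr01|move=> q _ _ l; lia].
  have [e e0 He] := IH (ltnW LK).
  have [|e' e'0 He'] := @wronskian_open R n K p (axis_freq n L.+1) pp; first by apply: W.
  exists (Num.min e e'); first by rewrite lt_min e0.
  move=> q pq dq l lL; have [|lL'] := leqP l L.
    move=> lL'; apply: He => //; last by lia.
    by apply: lt_le_trans dq _; rewrite lee_fin ge_min lexx.
  have -> : l = L.+1 by lia.
  by apply: He' => //; apply: lt_le_trans dq _; rewrite lee_fin ge_min lexx orbT.
- by move=> p e pp e0; have [q [pq dq Wq]] := wronskian_dense pp e0; exists q.
- by move=> p [pp W]; exact: independent_wronskian.
Qed.

End open_dense.

Theorem proposition2p1 (R : realType) (n : nat) (hn : (1 <= n)%N) :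
  (forall k : nat, (2 <= k)%N ->
    J_well_defined R n k /\
    constant_of_motion k (fun p : state R n => J_ p k)) /\
  (forall K : nat, (2 <= K)%N -> J_independent R n K).
Proof.
split=> [k k2|K K2]; last exact: J_independentP.
split; first exact: J_well_definedP.
by move=> I u v iI sol t1 t2 I1 I2; exact: (J_constant k2 iI sol).
Qed.
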